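(* Let $\epsilon>0$ and $\delta\in(0,1)$, and set $$T_r=\left\lceil\frac{\log(\delta/3K)}{\log(1-1/4K)}\right\rceil,\qquad T_s=\left\lceil\frac{8N^2}{\epsilon^2}\log\left(\frac{6NK}{\delta}\right)\right\rceil,\qquad T_b=\left\lceil\frac{8N^2}{\epsilon^2}\log\left(\frac{6K^2}{\delta}\right)\right\rceil .$$ Then, for any mean reward matrix $M$, the DOA-WS policy with inputs $K,T_s,T_r,T_b$ is $(\epsilon,\delta)$-optimal after $T_r+KT_s+KT_b$ rounds; that is, for every round $t>T_r+KT_s+KT_b$, the arms $\alpha^n_t$ selected by the players satisfy $$\Pr\left\{\sum_{n\in[N]}\mu_{n,\alpha^n_t}\ge\sum_{n\in[N]}\mu_{n,\pi^*(n)}-\epsilon\right\}\ge 1-\delta .$$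
   Context: Problem (wideband sensing). There are $N$ players and $K$ arms, $1\le N\le K$; $[m]=\{1,\dots,m\}$; $\log$ is the natural logarithm. For each player $n$ and arm $k$ there is an i.i.d. (over rounds $t$) reward process $S^n_k(t)$ with values in $[0,1]$ and mean $\mu_{n,k}$, independent across arms; $M=\{\mu_{n,k}\}$ is the mean reward matrix. In each round a player may transmit on (play) one arm. A player who plays an arm that nobody else plays receives $S^n_k(t)$; if two or more players play the same arm they collide (and notice it) and each receives $0$. Wideband sensing: in each round every player can also sense, for all arms simultaneously, whether a transmission occurs on them. Players have no other communication. $\Pi$ is the set of injective maps $\pi:[N]\to[K]$ and $\pi^*\in\arg\max_{\pi\in\Pi}\sum_n\mu_{n,\pi(n)}$. $\alpha^n_t$ denotes the arm selected by player $n$ in round $t$. DOA-WS policy (run separately by every player; inputs $K,T_s,T_r,T_b$). (1) Random Hopping ($T_r$ rounds). Each player plays an arm chosen uniformly at random from $[K]$, independently in each round, until she has a collision-free round; from then on she keeps playing that same arm. Let $k$ be her final arm. Transmitting on $k$ and sensing all other arms (in round $T_r$), she sets $A$ to be the set of arms $i\ne k$ on which a transmission is sensed, $N:=|A|+1$, and her index $n:=|\{j\in A:j<k\}|+1$. (2) Sequential Hopping ($KT_s$ rounds). Each player plays the arms cyclically (after arm $k$ the next arm modulo $K$), so each arm is played $T_s$ times by her and she ends on her arm $k$; $\hat\mu_{n,k}$ is (total reward obtained from arm $k$ in this phase)$/T_s$. (3) Bernoulli Signaling ($K$ frames of $T_b$ rounds each). Each player stays on her own arm during the whole phase. In each round of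 frame $j$, player $n$ transmits on her arm with probability $\hat\mu_{n,j}$, independently, and every player counts the number $o_{i,j}$ of rounds of frame $j$ in which a transmission occurs on arm $i$ (including her own arm). The estimates are $\widehat\mu_{i,j}=o_{i,j}/T_b$; after removing the $K-N$ rows of unoccupied arms, all players hold the same $N\times K$ matrix $\hat M$, whose $n$-th row corresponds to the player with index $n$ (each player uses the signaled values also for herself). (4) Each player computes an assignment $\hat\pi^*\in\arg\max_{\pi\in\Pi}\sum_n\hat M_{n,\pi(n)}$ by the same deterministic algorithm with the same deterministic tie-breaking rule, and the player with index $n$ plays arm $\hat\pi^*(n)$ in all later rounds. *)

(* Defs.v *)
From HB Require Import structures.
From mathcomp Require Import all_boot all_order all_algebra finmap.
From mathcomp Require Import all_classical all_reals all_analysis.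

(* MathComp-Analysis, over an arbitrary R : realType. *)

Set Implicit Arguments.
Unset Strict Implicit.
Unset Printing Implicit Defensive.

Import Order.TTheory GRing.Theory Num.Theory.
Import numFieldNormedType.Exports.

Local Open Scope classical_set_scope.
Local Open Scope ring_scope.

(* Players, arms and frames are numbered from 0 ('I_N, 'I_K); rounds are
   natural numbers numbered from 1.  A value at round 0 is never constrained. *)

Definition nat_ceil (R : realType) (x : R) : nat := `|Num.ceil x|%N.

Section Optimality.
Context {R : realType}.

(* pi \in argmax over injective maps *)
Definition optimal_assignment (m K : nat) (M : 'M[R]_(m, K))
    (pi : 'I_m -> 'I_K) : Prop :=
  injective pi /\
  forall rho : 'I_m -> 'I_K, injective rho ->
    \sum_i M i (rho i) <= \sum_i M i (pi i).

Definition optimal_after (d : measure_display) (T : measurableType d)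
    (P : probability T R) (N K : nat) (mu : 'M[R]_(N, K))
    (alpha : 'I_N -> nat -> T -> 'I_K) (eps delta : R) (T0 : nat) : Prop :=
  forall (t : nat) (pistar : 'I_N -> 'I_K),
    (T0 < t)%N -> optimal_assignment mu pistar ->
    ((1 - delta)%:E <=
     P [set w | (\sum_n mu n (pistar n) - eps <= \sum_n mu n (alpha n t w))%R]
    )%E.

End Optimality.

(* Frame j of Bernoulli Signaling consists of the rounds t such that
   frame_start K Tr Ts Tb j < t <= frame_start K Tr Ts Tb j.+1. *)
Definition frame_start (K Tr Ts Tb j : nat) : nat :=
  (Tr + K * Ts + j * Tb)%N.

Definition signaling_round (K Tr Ts Tb t : nat) : bool :=
  (frame_start K Tr Ts Tb 0 < t <= frame_start K Tr Ts Tb K)%N.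

Section Policy.
Context {R : realType} {N K : nat}.

(* Realized values:
   draw n t   : arm drawn by player n for round t of Random Hopping (it is
                discarded when n already keeps an arm);
   rew n k t  : value of the reward process S^n_k in round t;
   sig n t    : whether n transmits in round t of Bernoulli Signaling. *)
Variables (Tr Ts Tb : nat).
Variable assign : forall m, 'M[R]_(m, K) -> ('I_m -> 'I_K).
Variable draw : 'I_N -> nat -> 'I_K.
Variable rew : 'I_N -> 'I_K -> nat -> R.
Variable sig : 'I_N -> nat -> bool.

Definition collision_free (a : 'I_N -> 'I_K) (n : 'I_N) : bool :=
  [forall m : 'I_N, (m != n) ==> (a m != a n)].

(* the arm that each player keeps after the first t rounds, if any *)
Fixpoint kept (t : nat) : 'I_N -> option 'I_K :=
  if t is t'.+1 then
    let a := fun n => odflt (draw n t) (kept t' n) in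
    fun n => if collision_free a n then Some (a n) else kept t' n
  else fun=> None.

Definition hop_arm (t : nat) (n : 'I_N) : 'I_K :=
  odflt (draw n t) (kept t.-1 n).

Definition own_arm (n : 'I_N) : 'I_K := hop_arm Tr n.

(* What player n learns by sensing in round Tr.  Her estimate of the number of
   players is #|sensed n|.+1; her (0-based) index is an ordinal below it. *)
Definition sensed (n : 'I_N) : {set 'I_K} :=
  [set i | (i != own_arm n) && [exists m, own_arm m == i]].

Definition index_of (n : 'I_N) : 'I_(#|sensed n|.+1) :=
  inord #|[set i in sensed n | (i < own_arm n)%N]|.

Definition cyclic_arm (t : nat) (n : 'I_N) : 'I_K :=
  iter (t - Tr) (@ordS K) (own_arm n).

(* reward obtained by n in round t of Sequential Hopping *)
Definition obtained (n : 'I_N) (t : nat) : R :=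
  if collision_free (cyclic_arm t) n then rew n (cyclic_arm t n) t else 0.

Definition local_estimate (n : 'I_N) (k : 'I_K) : R :=
  (\sum_(Tr.+1 <= t < (Tr + K * Ts).+1 | cyclic_arm t n == k) obtained n t)
  / Ts%:R.

Definition transmissions (i j : 'I_K) : nat :=
  (\sum_((frame_start K Tr Ts Tb j).+1 <= t < (frame_start K Tr Ts Tb j.+1).+1)
     [exists n : 'I_N, (own_arm n == i) && sig n t])%N.

(* Matrix held by player n: one row per arm that she knows to be occupied, in
   increasing order of arms (enum of a set of ordinals is increasing). *)
Definition estimate (n : 'I_N) : 'M[R]_(#|sensed n|.+1, K) :=
  \matrix_(i, j)
    ((transmissions
       (nth (own_arm n) (enum (own_arm n |: sensed n)%SET) i) j)%:R / Tb%:R).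

Definition doaws_arm (n : 'I_N) (t : nat) : 'I_K :=
  if (t <= Tr)%N then hop_arm t n
  else if (t <= Tr + K * Ts)%N then cyclic_arm t n
  else if (t <= Tr + K * Ts + K * Tb)%N then own_arm n
  else assign (estimate n) (index_of n).

(* probability of the realized signals, for the given local estimates *)
Definition signal_weight : R :=
  \prod_(n < N) \prod_(j < K)
    \prod_((frame_start K Tr Ts Tb j).+1 <= t < (frame_start K Tr Ts Tb j.+1).+1)
      (if sig n t then local_estimate n j else 1 - local_estimate n j).

End Policy.

Section Law.
Context {R : realType} {d : measure_display} {T : measurableType d}.
Variable P : probability T R.

Definition mutually_independent (I : choiceType) (D : set I)
    (F : I -> set (set T)) : Prop :=
  (forall i, D i -> F i `<=` measurable) /\
  forall (J : {fset I}) (E : I -> set T),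
    (forall i, i \in J -> D i /\ F i (E i)) ->
    P (\bigcap_(i in [set` J]) E i) = (\prod_(i <- J) P (E i))%E.

Section Model.
Context {N K : nat}.
Variable mu : 'M[R]_(N, K).
Variable S : 'I_N -> 'I_K -> nat -> {RV P >-> R}.
Variable draw : 'I_N -> nat -> T -> 'I_K.
Variable sig : 'I_N -> nat -> T -> bool.

Definition reward_events (n : 'I_N) (k : 'I_K) (t : nat) : set (set T) :=
  preimage_set_system setT (S n k t) measurable.

Definition draw_events (n : 'I_N) (t : nat) : set (set T) :=
  preimage_set_system setT (draw n t) setT.

(* No assumption is made on the joint law of the rewards of different players. *)
Record reward_model : Prop := RewardModel {
  rew_range : forall n k t w, (0 < t)%N -> 0 <= S n k t w <= 1;
  rew_mean : forall n k t, (0 < t)%N -> ('E_P[S n k t] = (mu n k)%:E)%E;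
  rew_ident : forall n k t u (B : set R), (0 < t)%N -> (0 < u)%N ->
    measurable B -> distribution P (S n k t) B = distribution P (S n k u) B;
  rew_indep : forall n,
    mutually_independent [set kt : 'I_K * nat | (0 < kt.2)%N]
      (fun kt => reward_events n kt.1 kt.2) }.

(* sigma-algebra of the rewards of all players in all rounds *)
Definition reward_sigma : set (set T) :=
  <<s \bigcup_(i in [set i : 'I_N * 'I_K * nat | (0 < i.2)%N])
        reward_events i.1.1 i.1.2 i.2 >>.

(* None: the rewards; Some (n, t): the draw of n for round t *)
Definition hopping_sources (i : option ('I_N * nat)) : set (set T) :=
  if i is Some nt then draw_events nt.1 nt.2 else reward_sigma.

(* sigma-algebra of what happened in the first two phases *)
Definition history (Tr Ts : nat) : set (set T) :=
  <<s (\bigcup_(i in [set i : 'I_N * 'I_K * nat | (0 < i.2 <= Tr + K * Ts)%N])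
         reward_events i.1.1 i.1.2 i.2)
      `|`
      (\bigcup_(i in [set i : 'I_N * nat | (0 < i.2 <= Tr)%N])
         draw_events i.1 i.2) >>.

(* hop_indep: the draws are independent of each other and of the rewards.
   sig_law: conditionally on the first two phases, the signals are independent
   Bernoulli variables whose parameters are the local estimates; H is any event
   of the history and b any pattern of signals. *)
Record doaws_run (Tr Ts Tb : nat) : Prop := DoawsRun {
  hop_unif : forall n t k, (0 < t <= Tr)%N ->
    P [set w | draw n t w = k] = (K%:R^-1)%:E;
  hop_indep : mutually_independent
    [set i | if i is Some nt then (0 < nt.2 <= Tr)%N : Prop else True]
    hopping_sources;
  sig_meas : forall n t,
    signaling_round K Tr Ts Tb t -> measurable_fun setT (sig n t);
  sig_law : forall (b : 'I_N -> nat -> bool) (H : set T), history Tr Ts H ->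
    P (H `&` [set w | forall n t,
         signaling_round K Tr Ts Tb t -> sig n t w = b n t]) =
    (\int[P]_(w in H)
       (signal_weight Tr Ts Tb (fun n t => draw n t w) (fun n k t => S n k t w) b
       )%:E)%E }.

End Model.
End Law.

(* Main.v *)
Require Import Defs.
From HB Require Import structures.
From mathcomp Require Import all_boot all_order all_algebra finmap.
From mathcomp Require Import all_classical all_reals all_analysis.
From mathcomp Require Import measurable_realfun.
From mathcomp Require Import ring lra zify.

Set Implicit Arguments.
Unset Strict Implicit.
Unset Printing Implicit Defensive.

Import Order.TTheory GRing.Theory Num.Theory.
Import numFieldNormedType.Exports.

Local Open Scope classical_set_scope.
Local Open Scope ring_scope.

(** Everything is reduced to finite patterns: the draws of Random Hopping and
    the signals of Bernoulli Signaling take finitely many values, and on each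
    pair of patterns the final arms are fixed, so the success event is a finite
    union of measurable sets.  If every player keeps an arm, the arms in use are
    distinct; a player without an arm finds some arm unused by the others and
    draws it with probability [1 / K], so some player fails to keep an arm with
    probability at most [N (1 - 1 / K) ^ Tr <= delta / 3].  On a draw pattern
    where all players keep an arm, the local estimates average [Ts] i.i.d.
    rewards independent of the draws, and conditionally on them the signaled
    estimates average [Tb] Bernoulli variables; Hoeffding's inequality with
    deviation [eps / (4 N)] and a union bound cost [delta / 3] for each of the
    two steps.  Otherwise every entry of the common matrix is within
    [eps / (2 N)] of the mean, so an optimal assignment for it is [eps]-optimal. *)

(** * Hoeffding's inequality for finite product distributions *)

Lemma is_derive_congr (R : realType) (f g : R -> R) (x a b : R) :
  is_derive x 1 f a -> (forall y, g y = f y) -> a = b -> is_derive x 1 g b.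
Proof. by move=> fa /funext -> <-. Qed.

Lemma is_derive_ge0_ndecr0 (R : realType) (f df : R -> R) (x : R) :
  (forall y : R, is_derive y 1 f (df y)) -> (forall y, 0 < y -> 0 <= df y) ->
  0 <= x -> f 0 <= f x.
Proof.
move=> fdf df0 x0; apply: (@ger0_derive1_ndecry R f 0) => //.
- move=> y; rewrite in_itv/= andbT => y0.
  by have fy := fdf y; rewrite derive1E derive_val df0.
- by apply: derivable_within_continuous => y _; have [] := fdf y.
Qed.

(* The second derivative of the logarithm of the quotient of the two sides is
   1/4 - u (1 - u), with u = p e^s / (1 - p + p e^s). *)
Lemma bernoulli_mgf_le (R : realType) (p s : R) : 0 <= p <= 1 -> 0 <= s ->
  1 - p + p * expR s <= expR (s * p + s ^+ 2 / 8).
Proof.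
move=> /andP[p0 p1] s0.
pose D (x : R) := 1 - p + p * expR x.
have D_gt0 x : 0 < D x.
  rewrite /D; have := expR_gt0 x; move: p0; rewrite le_eqVlt => /predU1P[<-|p0] e0.
    by rewrite subr0 mul0r addr0.
  by rewrite ltr_wpDl ?subr_ge0// mulr_gt0.
pose f (x : R) := x * p + x ^+ 2 / 8 - ln (D x).
pose f1 (x : R) := p - 1 + x / 4 + (1 - p) / D x.
pose f2 (x : R) := 1 / 4 - (1 - p) * (p * expR x) / D x ^+ 2.
have dD (x : R) : is_derive x 1 D (p * expR x).
  have := is_deriveD (is_derive_cst (1 - p) x 1)
                     (is_deriveZ p (is_derive_expR x)).
  by rewrite add0r.
have df1 (x : R) : is_derive x 1 f1 (f2 x).
  have h := is_deriveD (is_deriveD (is_derive_cst (p - 1) x 1)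
     (is_deriveZ (4^-1) (is_derive_id x 1)))
     (is_deriveZ (1 - p) (is_deriveV (lt0r_neq0 (D_gt0 x)) (dD x))).
  apply: (is_derive_congr h) => [y|]; first by congr (_ + _ + _); exact: mulrC.
  have := D_gt0 x; rewrite /f2 /GRing.scale/=; set d := D x => d0.
  by field; rewrite gt_eqF.
have df (x : R) : is_derive x 1 f (f1 x).
  have h := is_deriveB (is_deriveD (is_deriveZ p (is_derive_id x 1))
     (is_deriveZ (8^-1) (is_deriveX 2 (is_derive_id x 1))))
     (is_derive1_comp (is_derive1_ln (D_gt0 x)) (dD x)).
  apply: (is_derive_congr h) => [y|]; first by congr (_ + _ - _); exact: mulrC.
  have := D_gt0 x; rewrite /f1 /GRing.scale/=; set d := D x => d0.
  have -> : p * expR x = d - 1 + p by rewrite /d /D; ring.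
  by rewrite /GRing.exp/=; field; rewrite gt_eqF.
have f2_ge0 x : 0 <= f2 x.
  (* With a = [1 - p] and b = [p * expR x], so that [D x] is a + b, the claim is 4 a b <= (a +
     b)^2. *)
  rewrite /f2 subr_ge0 ler_pdivrMr ?exprn_gt0 ?D_gt0// /D.
  have := sqr_ge0 (1 - p - p * expR x); nra.
have f10 : f1 0 = 0 by rewrite /f1 /D expR0; field; lra.
have f1_ge0 x : 0 <= x -> 0 <= f1 x.
  by move=> x0; rewrite -f10; apply: (is_derive_ge0_ndecr0 df1).
have : f 0 <= f s by apply: (is_derive_ge0_ndecr0 df) => // y /ltW/f1_ge0.
rewrite /f/= /D expR0 mulr1 subrK ln1 mul0r expr0n/= mul0r addr0 subrr subr_ge0.
by rewrite -ler_expR lnK// posrE; exact: D_gt0.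
Qed.

(** Convexity of the exponential between the points 0 and [s]. *)
Lemma expR_le_chord (R : realType) (s y : R) : 0 <= y <= 1 ->
  expR (s * y) <= 1 - y + y * expR s.
Proof.
move=> /[dup] y01 /andP[y0 y1].
have := @convex_expR R (Itv01 y0 y1) (s : R^o) (0 : R^o).
rewrite !convRE /= expR0 !mulr0 !mulr1 addr0 mulrC => /le_trans; apply.
by rewrite addrC.
Qed.

(** The chord bound is affine in the mean with slope [expR s - 1 >= 0], so the mean may be replaced
    by its upper bound [p], and [bernoulli_mgf_le] applies. The mean is only bounded above because
    rounding down lowers it. *)
Lemma hoeffding_mgf_le (R : realType) (V : finType) (w x : V -> R) (p s : R) :
  (forall v, 0 <= w v) -> \sum_v w v = 1 -> (forall v, 0 <= x v <= 1) ->
  \sum_v w v * x v <= p -> p <= 1 -> 0 <= s ->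
  \sum_v w v * expR (s * (x v - p)) <= expR (s ^+ 2 / 8).
Proof.
move=> w0 w1 x01 xp p1 s0.
have p0 : 0 <= p.
  apply: le_trans xp; apply: sumr_ge0 => v _.
  by rewrite mulr_ge0//; case/andP: (x01 v).
rewrite (eq_bigr (fun v => w v * expR (s * x v) * expR (- (s * p)))); last first.
  by move=> v _; rewrite mulrBr expRD mulrA.
rewrite -mulr_suml expRN ler_pdivrMr ?expR_gt0// -expRD addrC.
apply: le_trans (bernoulli_mgf_le _ s0); last by rewrite p0 p1.
apply: (@le_trans _ _ (\sum_v (w v + w v * x v * (expR s - 1)))).
  apply: ler_sum => v _; rewrite (_ : w v + _ = w v * (1 - x v + x v * expR s)).
    by rewrite ler_wpM2l// expR_le_chord.
  by ring.
rewrite big_split/= w1 -mulr_suml -addrA lerD2l.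
rewrite (_ : - p + p * expR s = p * (expR s - 1)); last by ring.
by rewrite ler_wpM2r// subr_ge0 -expR0 ler_expR.
Qed.

(** Chernoff's method: the indicator of the event is at most the exponential of [s] times the excess
    over [a], and the sum over all [f] of a product is a product of sums. Coordinates outside [A]
    contribute a factor 1, which lets [A] be one frame among all slots of a signal pattern. *)
Lemma hoeffding_finite (R : realType) (I V : finType) (A : {pred I})
    (w : I -> V -> R) (x : V -> R) (p : I -> R) (s a : R) :
  (forall i v, 0 <= w i v) -> (forall i, \sum_v w i v = 1) ->
  (forall v, 0 <= x v <= 1) ->
  (forall i, i \in A -> \sum_v w i v * x v <= p i <= 1) -> 0 <= s ->
  \sum_(f : {ffun I -> V} | a <= \sum_(i in A) (x (f i) - p i))
     \prod_i w i (f i)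
  <= expR (#|A|%:R * (s ^+ 2 / 8) - s * a).
Proof.
move=> w0 w1 x01 xp s0.
pose g i v := if i \in A then w i v * expR (s * (x v - p i)) else w i v.
apply: (@le_trans _ _ (\sum_(f : {ffun I -> V}) (\prod_i g i (f i)) * expR (- (s * a)))).
  rewrite big_mkcond/=; apply: ler_sum => f _.
  have P0 : 0 <= \prod_i w i (f i) by apply: prodr_ge0.
  rewrite (_ : \prod_i g i (f i) =
     \prod_i w i (f i) * expR (s * \sum_(i in A) (x (f i) - p i))); last first.
    rewrite mulr_sumr expR_sum [X in _ * X]big_mkcond -big_split/=.
    by apply: eq_bigr => i _; rewrite /g; case: ifP; rewrite ?mulr1.
  case: ifPn => [aA|_]; last by rewrite !mulr_ge0// ?expR_ge0.
  rewrite -mulrA -expRD ler_peMr// -expR0 ler_expR.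
  by rewrite -mulrBr mulr_ge0// subr_ge0.
rewrite -mulr_suml -(bigA_distr_bigA g) expRD ler_wpM2r ?expR_ge0//.
rewrite mulr_natl -sumr_const expR_sum.
rewrite [leRHS]big_mkcond/=; apply: ler_prod => i _.
rewrite sumr_ge0/=; last by move=> v _; rewrite /g; case: ifP; rewrite ?mulr_ge0// ?expR_ge0.
rewrite /g; case: ifPn => iA; last by rewrite w1.
by case/andP: (xp _ iA) => ? ?; exact: hoeffding_mgf_le.
Qed.

(** * Hoeffding's inequality for independent random variables *)

Lemma bigsetUP (T : Type) (I : finType) (Q : pred I) (F : I -> set T) (w : T) :
  (\big[setU/set0]_(i | Q i) F i) w <-> exists2 i, Q i & F i w.
Proof.
split; last by move=> [i Qi Fi]; rewrite (bigD1 i)//=; left.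
by elim/big_rec : _ => // i S Qi IH [Fi|/IH//]; exists i.
Qed.

Lemma measure_le_fin_cover d (T : measurableType d) (R : realType)
    (mu : {measure set T -> \bar R}) (I : finType) (Q : pred I)
    (A : set T) (F : I -> set T) :
  measurable A -> (forall i, Q i -> measurable (F i)) ->
  (forall w, A w -> exists2 i, Q i & F i w) ->
  (mu A <= \sum_(i | Q i) mu (F i))%E.
Proof.
move=> mA mF AF.
apply: (@le_trans _ _ (mu (\big[setU/set0]_(i | Q i) F i))).
  apply: le_measure; rewrite ?inE//; first exact: bigsetU_measurable.
  by move=> w /AF; rewrite bigsetUP.
suff [] : measurable (\big[setU/set0]_(i | Q i) F i) /\
  (mu (\big[setU/set0]_(i | Q i) F i) <= \sum_(i | Q i) mu (F i))%E by [].
elim/big_rec2 : _ => [|i y1 y2 Qi [m1 h]]; first by rewrite measure0.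
split; first by apply: measurableU => //; exact: mF.
by rewrite (le_trans (measureU2 _ _ _))//; [exact: mF|rewrite leeD2l].
Qed.

(* Rounding down to multiples of 1 / q turns independence, which is stated for
   events, into a product law on a finite type; q then tends to infinity. *)
Section Discretization.
Context {R : realType}.
Variable q : nat.
Hypothesis q0 : (0 < q)%N.

(** Index [q] gives the cell [1, 1 + 1/q), which holds the value 1. *)
Definition cell (v : 'I_q.+1) : set R :=
  [set` `[v%:R / q%:R, v.+1%:R / q%:R[].

Definition cell_index (x : R) : 'I_q.+1 := inord (Num.truncn (q%:R * x)).

Lemma cellE (x : R) (v : 'I_q.+1) : 0 <= x <= 1 ->
  cell v x <-> v = cell_index x.
Proof.
move=> /andP[x0 x1]; rewrite /cell/= in_itv/= /cell_index.
have qR : 0 < q%:R :> R by rewrite ltr0n.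
have qx0 : 0 <= q%:R * x by rewrite mulr_ge0// ltW.
have lt : (Num.truncn (q%:R * x) < q.+1)%N.
  rewrite ltnS -(ler_nat R).
  have /andP[h _] := truncn_itv qx0; apply: le_trans h _.
  by rewrite ger_pMr.
rewrite ler_pdivrMr// ltr_pdivlMr// mulrC -truncn_eq//.
split=> [/eqP tv|->]; last by rewrite inordK.
by apply: val_inj; rewrite /= -tv inordK.
Qed.

Lemma cell_index_le (x : R) : 0 <= x <= 1 ->
  (cell_index x)%:R / q%:R <= x < (cell_index x)%:R / q%:R + q%:R^-1.
Proof.
move=> x01; have /(_ erefl) := (cellE (cell_index x) x01).2.
by rewrite /cell/= in_itv/= -natr1 mulrDl mul1r.
Qed.

(** Only the indicator of the cell containing [X w] survives. A function of the cell is thus a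
    simple function, which yields its measurability and its integral. *)
Lemma cell_indicE (T : Type) (X : T -> R) (c : 'I_q.+1 -> R) (w : T) :
  0 <= X w <= 1 ->
  c (cell_index (X w)) = \sum_v c v * \1_(X @^-1` cell v) w.
Proof.
move=> X01; rewrite (bigD1 (cell_index (X w)))//= big1 => [|v vX].
  by rewrite indicE mem_set ?mulr1 ?addr0//; exact/(cellE _ X01).
rewrite indicE memNset ?mulr0//.
by move/(cellE _ X01) => vE; rewrite vE eqxx in vX.
Qed.

Section Law.
Context d (T : measurableType d) (P : probability T R).
Variable X : T -> R.
Hypotheses (mX : measurable_fun setT X) (X01 : forall w, 0 <= X w <= 1).

Lemma measurable_cell (v : 'I_q.+1) : measurable (X @^-1` cell v).
Proof.
by rewrite -[X in measurable X]setTI; apply: mX => //; exact: measurable_itv.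
Qed.

Lemma measurable_cell_index (c : 'I_q.+1 -> R) :
  measurable_fun setT (fun w => c (cell_index (X w))).
Proof.
rewrite (_ : (fun w => _) =
    (fun w => \sum_v c v * \1_(X @^-1` cell v) w)); last first.
  by apply/funext => w; exact: cell_indicE.
apply: measurable_sum => v; apply: measurable_funM => //.
by apply: measurable_indic; exact: measurable_cell.
Qed.

Lemma sum_cell (c : 'I_q.+1 -> R) : (forall v, 0 <= c v) ->
  (\sum_v (c v)%:E * P (X @^-1` cell v) = \int[P]_w (c (cell_index (X w)))%:E)%E.
Proof.
move=> c0.
have mI v : measurable_fun setT (\1_(X @^-1` cell v) : T -> R).
  by apply: measurable_indic; exact: measurable_cell.
transitivity (\int[P]_w \sum_v ((c v)%:E * (\1_(X @^-1` cell v) w)%:E))%E.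
  rewrite ge0_integral_sum//.
  - apply: eq_bigr => v _; rewrite ge0_integralZl_EFin//.
    + by rewrite integral_indic ?setIT//; exact: measurable_cell.
    + exact/measurable_EFinP.
  - by move=> v; apply/measurable_EFinP; apply: measurable_funM.
  - by move=> v w _; rewrite -EFinM lee_fin mulr_ge0.
apply: eq_integral => w _; rewrite cell_indicE// -sumEFin.
by apply: eq_bigr => v _; rewrite EFinM.
Qed.

End Law.

End Discretization.

(** The passage to the limit in [q]: if [expR c < x], any [q] above [b / (ln x - c)] contradicts the
    hypothesis. *)
Lemma le_of_expR_le (R : realType) (x c b : R) : 0 <= b ->
  (forall q : nat, (0 < q)%N -> x <= expR (c + b / q%:R)) -> x <= expR c.
Proof.
move=> b0 h; rewrite leNgt; apply/negP => cx.
have x0 : 0 < x by apply: lt_trans cx; exact: expR_gt0.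
have e0 : 0 < ln x - c by rewrite subr_gt0 -ltr_expR lnK.
have be0 : 0 <= b / (ln x - c) by rewrite divr_ge0// ltW.
have := archi_boundP be0; set q := Num.bound _ => bq.
have q0 : (0 < q)%N.
  by rewrite -(ltr_nat R); apply: le_lt_trans bq.
have := h _ q0; rewrite leNgt => /negP; apply.
rewrite -[ltRHS]lnK ?posrE// ltr_expR -ltrBrDl ltr_pdivrMr ?ltr0n//.
by rewrite mulrC -ltr_pdivrMr.
Qed.

(** The rounded values have a product law on a finite type, to which [hoeffding_finite] applies.
    Rounding down keeps the means below [p] and lowers each term by less than 1/q, so the threshold
    drops by [#|A|%:R / q%:R]; the resulting extra term in the exponent vanishes in the limit. *)
Lemma hoeffding_upper_tail d (T : measurableType d) (R : realType)
    (P : probability T R) (I : finType) (A : {pred I}) (X : I -> T -> R)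
    (p s a : R) :
  (forall i, measurable_fun setT (X i)) -> (forall i w, 0 <= X i w <= 1) ->
  (forall i, \int[P]_w (X i w)%:E <= p%:E)%E -> p <= 1 ->
  (forall B : I -> set R, (forall i, measurable (B i)) ->
     P [set w | forall i, B i (X i w)] = (\prod_i P (X i @^-1` B i))%E) ->
  0 <= s ->
  (P [set w | (a <= \sum_(i in A) (X i w - p))%R] <=
   (expR (#|A|%:R * (s ^+ 2 / 8) - s * a))%:E)%E.
Proof.
move=> mX X01 Xp p1 indep s0.
set Z := [set w | _].
have mZ : measurable Z.
  rewrite /Z -[X in measurable X]setTI.
  apply: measurable_fun_le => //.
  rewrite (_ : (fun x => _) = (fun w => \sum_(i <- enum A) (X i w - p))); last first.
    by apply/funext => w; rewrite big_enum.
  by apply: measurable_sum => i; apply: measurable_funB.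
have fZ : P Z \is a fin_num by apply: fin_num_measure.
rewrite -(fineK fZ) lee_fin.
apply: (@le_of_expR_le _ _ _ (s * #|A|%:R)); first by rewrite mulr_ge0.
move=> q q0.
have mcell i (v : 'I_q.+1) := @measurable_cell _ q _ _ _ (mX i) v.
pose w i (v : 'I_q.+1) := fine (P (X i @^-1` cell v)).
have wE i v : P (X i @^-1` cell v) = (w i v)%:E.
  by rewrite fineK//; apply: fin_num_measure.
have sumw i (c : 'I_q.+1 -> R) : (forall v, 0 <= c v) ->
    (\sum_v w i v * c v)%:E = (\int[P]_y (c (cell_index q (X i y)))%:E)%E.
  move=> c0; rewrite -sum_cell// -sumEFin; apply: eq_bigr => v _.
  by rewrite wE EFinM muleC.
have qR : 0 < q%:R :> R by rewrite ltr0n.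
pose y (v : 'I_q.+1) : R := v%:R / q%:R.
have y01 v : 0 <= y v <= 1.
  rewrite /y divr_ge0//= ler_pdivrMr// mul1r ler_nat -ltnS; exact: ltn_ord.
have ub := @hoeffding_finite R I _ A w y (fun=> p) s (a - #|A|%:R / q%:R) _ _ y01 _ s0.
rewrite (_ : _ + s * #|A|%:R / _ = #|A|%:R * (s ^+ 2 / 8) - s * (a - #|A|%:R / q%:R)); last first.
  by rewrite mulrBr opprB [s * (_ / _)]mulrA -addrA [- _ + _]addrC.
apply: le_trans (ub _ _ _); last first.
- move=> i _; rewrite p1 andbT -lee_fin sumw; last by move=> v; case/andP: (y01 v).
  apply: le_trans (Xp i); apply: ge0_le_integral => //.
  + by move=> z _; rewrite lee_fin; case/andP: (y01 (cell_index q (X i z))).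
  + apply/measurable_EFinP.
    exact: (measurable_cell_index q0 (mX i) (X01 i) y).
  + exact/measurable_EFinP.
  + by move=> z _; rewrite lee_fin; case/andP: (cell_index_le q0 (X01 i z)).
- move=> i; apply: EFin_inj; rewrite (eq_bigr (fun v => w i v * 1)); last by move=> *; rewrite mulr1.
  by rewrite (sumw i (fun=> 1)) // integral_cst// mul1e; exact: probability_setT.
- by move=> i v; rewrite fine_ge0.
rewrite -lee_fin fineK// -sumEFin.
(* Each outcome of [Z] lies in the box of cells of its own values, and independence gives the
   measure of every box as a product. *)
apply: (@le_trans _ _ (\sum_(f : {ffun I -> 'I_q.+1} | (a - #|A|%:R / q%:R <= \sum_(i in A) (y (f i) - p))%R)
   P [set z | forall i, cell (f i) (X i z)])%E).
  apply: measure_le_fin_cover => //.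
  - move=> f _; rewrite (_ : [set _ | _] = \bigcap_(i in setT) (X i @^-1` cell (f i))).
      by apply: fin_bigcap_measurable.
    by apply/seteqP; split=> z h i; [move=> _|]; exact: h.
  - move=> z Zz; exists [ffun i => cell_index q (X i z)]; last first.
      by move=> i; rewrite ffunE; apply/cellE.
    rewrite lerBlDr (le_trans Zz)// mulr_natl -sumr_const -big_split/=.
    apply: ler_sum => i _; rewrite ffunE addrAC lerD2r ltW//.
    by case/andP: (cell_index_le q0 (X01 i z)).
apply: lee_sum => f _; rewrite (indep (fun i => cell (f i))); last by move=> i; exact: measurable_itv.
by rewrite -prodEFin; under eq_bigr do rewrite wE.
Qed.

(** * Random hopping *)

Section Resampling.
Context {I V : finType}.
Implicit Types (f : {ffun I -> V}) (i : I) (v : V).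

Definition upd f i v : {ffun I -> V} := [ffun j => if j == i then v else f j].

(** The second component stores the overwritten value, so a second application restores it. *)
Lemma upd_involutive i :
  involutive (fun fv : {ffun I -> V} * V => (upd fv.1 i fv.2, fv.1 i)).
Proof.
move=> [f v] /=; rewrite ffunE eqxx; congr pair.
by apply/ffunP => j; rewrite !ffunE; case: eqP => // ->.
Qed.

(* [upd_involutive] exchanges the pairs (f in B, v) with the pairs (f in A, v)
   such that [upd f i v] lies in B. *)
Lemma card_resample i (A B : {set {ffun I -> V}}) :
  (forall f v, f \in A -> upd f i v \in A) -> B \subset A ->
  (forall f, f \in A -> exists v, upd f i v \notin B) ->
  (#|B| * #|V| <= #|A| * #|V|.-1)%N.
Proof.
move=> updA BA escape.
pose phi (fv : {ffun I -> V} * V) := (upd fv.1 i fv.2, fv.1 i).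
pose D := [set fv : {ffun I -> V} * V | (fv.1 \in A) && (upd fv.1 i fv.2 \in B)]%SET.
have -> : (#|B| * #|V| = #|phi @: finset.setX B [set: V]%SET|)%N.
  by rewrite card_imset ?cardsX ?finset.cardsT//; exact: inv_inj (upd_involutive i).
have /subset_leq_card/leq_trans : phi @: finset.setX B [set: V]%SET \subset D.
  apply/fintype.subsetP => _ /imsetP[[f v] + ->].
  rewrite inE/= => /andP[fB _]; rewrite inE/=.
  have := upd_involutive i (f, v) => /= [[-> _]].
  by rewrite fB andbT updA//; apply: (fintype.subsetP BA).
apply.
rewrite (eq_card (B := mem [set fv | (fv.1 \in A) && (fv.2 \in [set v | upd fv.1 i v \in B])]%SET)); last first.
  by move=> fv; rewrite !inE.
rewrite -sum1_card.
under eq_bigl do rewrite inE.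
rewrite -(pair_big_dep (fun f => f \in A)
  (fun f v => v \in [set v | upd f i v \in B]%SET) (fun _ _ => 1%N))/=.
rewrite -sum_nat_const; apply: leq_sum => f fA.
(* In the fibre over [f], one value escapes [B], which leaves at most [#|V|.-1] of them. *)
have [v vB] := escape f fA.
rewrite sum1_card -ltnS prednK; last by apply/card_gt0P; exists v.
rewrite -finset.cardsT; apply: proper_card; apply/properP; split; first exact: finset.subsetT.
by exists v; rewrite ?inE.
Qed.

End Resampling.

Section RandomHopping.
Context {N K : nat}.
Implicit Types (draw : 'I_N -> nat -> 'I_K) (n m : 'I_N) (t : nat).

Lemma eq_kept draw draw' t :
  (forall n s, (0 < s <= t)%N -> draw n s = draw' n s) ->
  kept draw t = kept draw' t.
Proof.
elim: t => [//|t IH] dd; have IHt : kept draw t = kept draw' t.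
  by apply: IH => n s /andP[s0 st]; apply: dd; rewrite s0 ltnW.
apply/funext => n /=; rewrite IHt.
have -> : (fun n => odflt (draw n t.+1) (kept draw' t n)) =
          (fun n => odflt (draw' n t.+1) (kept draw' t n)).
  by apply/funext => m; rewrite dd ?leqnn.
by rewrite dd// leqnn.
Qed.

Lemma keptS_hop_arm draw t n k :
  kept draw t.+1 n = Some k -> hop_arm draw t.+1 n = k.
Proof. by rewrite /hop_arm /=; case: ifP => [_ [] //|_ ->]. Qed.

(** By induction: two distinct players holding the same arm after round [t.+1] both played it in
    that round, so neither was collision-free there and both held it before. *)
Lemma kept_inj draw t n m k :
  kept draw t n = Some k -> kept draw t m = Some k -> n = m.
Proof.
elim: t n m => [//|t IH] n m kn km; apply/eqP/negPn/negP => nm.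
have := keptS_hop_arm km; have := keptS_hop_arm kn; rewrite /hop_arm/= => an am.
move: kn km => /=; case: ifPn => [/forallP/(_ m)|_].
  by rewrite eq_sym nm an am eqxx.
move=> kn; case: ifPn => [/forallP/(_ n)|_ km]; first by rewrite nm an am eqxx.
by move: nm; rewrite (IH _ _ kn km) eqxx.
Qed.

Lemma own_arm_inj draw t : (0 < t)%N ->
  (forall n, kept draw t n != None) -> injective (own_arm t draw).
Proof.
case: t => // t _ all_kept n m; rewrite /own_arm.
case kn : (kept draw t.+1 n) (all_kept n) => [k|//] _.
case km : (kept draw t.+1 m) (all_kept m) => [l|//] _.
rewrite (keptS_hop_arm kn) (keptS_hop_arm km) => kl.
by apply: (kept_inj kn); rewrite kl.
Qed.

Lemma keptS_None draw t n : kept draw t.+1 n = None -> kept draw t n = None.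
Proof. by rewrite /=; case: ifP. Qed.

Variable r : nat.

(** Rounds start at 1 and ordinals at 0, hence the shift by one; the pattern describes rounds 1 to
    [r.+1], and [inord] supplies a default elsewhere. *)
Definition pattern_draw (c : {ffun 'I_N * 'I_r.+1 -> 'I_K}) n t : 'I_K :=
  c (n, inord t.-1).

Lemma pattern_draw_upd c n m t k (s : nat) : (0 < s <= r.+1)%N -> (t <= r)%N ->
  pattern_draw (upd c (n, inord t) k) m s =
  if (m == n) && (s == t.+1) then k else pattern_draw c m s.
Proof.
move=> /andP[s0 sr] tr; rewrite /pattern_draw ffunE xpair_eqE.
suff -> : (inord s.-1 == inord t :> 'I_r.+1) = (s == t.+1) by [].
by rewrite -(inj_eq val_inj)/= !inordK//; [apply/eqP/eqP; lia|lia].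
Qed.

(** The other players occupy at most [N - 1 < K] arms. *)
Lemma exists_free_arm (a : 'I_N -> 'I_K) n : (N <= K)%N ->
  exists k, forall m, m != n -> a m != k.
Proof.
move=> NK.
have /subsetPn[k _ kA] : ~~ ([set: 'I_K] \subset [set a m | m in [set~ n]])%SET.
  apply/negP => /subset_leq_card; rewrite finset.cardsT card_ord leqNgt => /negP; apply.
  apply: leq_ltn_trans (leq_imset_card _ _) _.
  rewrite cardsC1 card_ord; have := ltn_ord n; lia.
exists k => m mn; apply: contra kA => /eqP <-.
by apply/imsetP; exists m; rewrite ?inE.
Qed.

(** Counting form of the bound (1 - 1/K)^t on the probability that [n] has no arm after [t] rounds,
    out of [K ^ (N * r.+1)] patterns. Induction on [t]: resampling the draw of [n] for round [t.+1]
    leaves the first [t] rounds unchanged, and some value gives her an arm, so [card_resample]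
    yields the factor (K - 1)/K. *)
Lemma card_not_kept n t : (N <= K)%N -> (t <= r.+1)%N ->
  (#|[set c | kept (pattern_draw c) t n == None]%SET| * K ^ t <=
   K.-1 ^ t * K ^ (N * r.+1))%N.
Proof.
move=> NK; elim: t => [_|t IH tr].
  rewrite !expn0 muln1 mul1n (leq_trans (max_card _))//.
  by rewrite card_ffun card_prod !card_ord.
have {IH} := IH (ltnW tr); rewrite ltnS in tr.
have same c k : kept (pattern_draw (upd c (n, inord t) k)) t = kept (pattern_draw c) t.
  apply: eq_kept => m s /andP[s0 st].
  rewrite pattern_draw_upd//; last by rewrite s0; lia.
  by rewrite ifF//; apply/negbTE; lia.
set A := [set c | kept (pattern_draw c) t n == None]%SET.
set B := [set c | kept (pattern_draw c) t.+1 n == None]%SET => IH.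
suff : (#|B| * K <= #|A| * K.-1)%N.
  move=> BA; rewrite !expnS mulnA (leq_trans (leq_mul BA (leqnn _)))//.
  by rewrite [(#|A| * _)%N]mulnC -!mulnA leq_mul.
rewrite -[K in (_ * K <= _)%N](card_ord K) -[K in (_ <= _ * K.-1)%N](card_ord K).
apply: (card_resample (i := (n, inord t))).
- by move=> c k; rewrite !inE same.
- by apply/fintype.subsetP => c; rewrite !inE => /eqP/keptS_None ->.
move=> c; rewrite inE => /eqP cA.
(* The arms of the others in round [t.+1] do not depend on the resampled draw, so an arm free of
   them is kept by [n] when she draws it. *)
pose a m := odflt (pattern_draw c m t.+1) (kept (pattern_draw c) t m).
have [k kfree] := exists_free_arm a n NK.
exists k; rewrite inE /= same.
set a' := (fun m => _).
have a'n : a' n = k.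
  by rewrite /a' cA/= pattern_draw_upd ?ltnS// !eqxx.
rewrite ifT//; apply/forallP => m; apply/implyP => mn; rewrite a'n.
have -> : a' m = a m; last exact: kfree.
rewrite /a' /a pattern_draw_upd ?ltnS//.
by rewrite (negbTE mn).
Qed.

End RandomHopping.

(** * Sequential hopping and the final assignment *)

Section CyclicArms.
Context {K : nat}.
Implicit Types (k l : 'I_K).

Lemma val_iter_ordS i k : iter i (@ordS K) k = ((k + i) %% K)%N :> nat.
Proof.
elim: i => [|i IH]; first by rewrite addn0 modn_small.
by rewrite iterS/= IH addnS -addn1 modnDml addn1.
Qed.

Lemma iter_ordS_inj i : injective (iter i (@ordS K)).
Proof.
move=> k l /(congr1 val); rewrite /= !val_iter_ordS => /eqP.
by rewrite eqn_modDr !modn_small// => /eqP/val_inj.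
Qed.

(** [K] consecutive shifts permute the arms; a phase of [K * T] rounds is made of [T] such
    periods. *)
Lemma sum_iter_ordS_period a k l :
  (\sum_(i < K) (iter (a + i) (@ordS K) k == l) = 1)%N.
Proof.
have h_inj : injective (fun i : 'I_K => iter (a + i) (@ordS K) k).
  move=> i j /(congr1 val); rewrite /= !val_iter_ordS !addnA => /eqP.
  by rewrite eqn_modDl !modn_small// => /eqP/val_inj.
transitivity (\sum_(i < K) (i == l :> 'I_K))%N.
  by rewrite [RHS](reindex_inj h_inj).
by rewrite (bigD1 l)//= eqxx big1// => i /negbTE ->.
Qed.

Lemma card_iter_ordS (T : nat) k l :
  #|[pred i : 'I_(K * T) | iter i.+1 (@ordS K) k == l]| = T.
Proof.
rewrite -sum1_card big_mkcond/=.
under eq_bigr => i _ do rewrite inE -[X in if X then _ else _]/(_ == _).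
transitivity (\sum_(0 <= i < K * T) (iter i.+1 (@ordS K) k == l))%N.
  by rewrite big_mkord; apply: eq_bigr => i _; case: eqP.
elim: T => [|T IH]; first by rewrite muln0 big_nil.
rewrite mulnS addnC (@big_cat_nat _ _ _ (K * T))//= ?leq_addr// IH.
rewrite -[X in index_iota X _]add0n big_addn addKn big_mkord.
rewrite -[RHS]addn1; congr (_ + _)%N.
rewrite -[RHS](sum_iter_ordS_period (K * T).+1 k l).
by apply: eq_bigr => i _; rewrite addSn addnC.
Qed.

End CyclicArms.

Section LocalEstimate.
Context {R : realType} {N K : nat}.
Variables (Tr Ts : nat) (draw : 'I_N -> nat -> 'I_K).
Variable rew : 'I_N -> 'I_K -> nat -> R.
Hypothesis Ts0 : (0 < Ts)%N.

(** Rounds of Sequential Hopping are renumbered from 0: [i] stands for round [i + Tr.+1], in which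
    the arm has been shifted [i.+1] times. *)
Definition visits (n : 'I_N) (k : 'I_K) : {pred 'I_(K * Ts)} :=
  [pred i : 'I_(K * Ts) | iter i.+1 (@ordS K) (own_arm Tr draw n) == k].

Lemma card_visits n k : #|visits n k| = Ts.
Proof. exact: card_iter_ordS. Qed.

Lemma local_estimateE n k : local_estimate Tr Ts draw rew n k =
  (\sum_(i in visits n k) obtained Tr draw rew n (i + Tr.+1)) / Ts%:R.
Proof.
congr (_ / _); rewrite -[X in index_iota X _]add0n big_addn subSS addKn big_mkord.
apply: eq_bigl => i.
by rewrite /cyclic_arm addnS -addSn addnK inE.
Qed.

(** There are exactly [Ts] visits, each worth at most 1. Collisions are allowed here, since the
    estimate must be a valid Bernoulli parameter on every draw pattern. *)
Lemma local_estimate_ge0_le1 n k :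
  (forall n k t, (0 < t)%N -> 0 <= rew n k t <= 1) ->
  0 <= local_estimate Tr Ts draw rew n k <= 1.
Proof.
move=> rew01.
have ob01 t : (0 < t)%N -> 0 <= obtained Tr draw rew n t <= 1.
  by move=> t0; rewrite /obtained; case: ifP => _; rewrite ?rew01// lexx ler01.
rewrite local_estimateE divr_ge0//=; last first.
  by apply: sumr_ge0 => i _; have /ob01/andP[]// : (0 < i + Tr.+1)%N by rewrite addnS.
rewrite ler_pdivrMr ?ltr0n// mul1r -[X in _ <= X%:R](card_visits n k).
rewrite -sumr_const; apply: ler_sum => i _.
have /ob01/andP[]// : (0 < i + Tr.+1)%N by rewrite addnS.
Qed.

(** Distinct arms stay distinct under a common cyclic shift, so no collision occurs and every visit
    yields the raw reward. *)
Lemma local_estimate_inj n k : injective (own_arm Tr draw) ->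
  local_estimate Tr Ts draw rew n k =
  (\sum_(i in visits n k) rew n k (i + Tr.+1)) / Ts%:R.
Proof.
move=> own_inj; rewrite local_estimateE; congr (_ / _); apply: eq_bigr => i.
rewrite inE => /eqP ik; rewrite /obtained ifT.
  by rewrite /cyclic_arm addnS -addSn addnK ik.
apply/forallP => m; apply/implyP; apply: contra => /eqP.
by move=> /iter_ordS_inj/own_inj ->.
Qed.

End LocalEstimate.

(** Links the index that a player gets by counting smaller occupied arms to the position of her arm
    in the sorted list that labels the rows. *)
Lemma index_sorted_count (K : nat) (s : seq 'I_K) (x : 'I_K) :
  sorted (fun i j : 'I_K => (i < j)%N) s -> x \in s ->
  index x s = count (fun y : 'I_K => (y < x)%N) s.
Proof.
have tr : transitive (fun i j : 'I_K => (i < j)%N) by move=> ? ? ?; exact: ltn_trans.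
elim: s => //= a s IH as_; rewrite inE eq_sym.
have /allP alla := order_path_min tr as_.
case: eqP => [<- _|_ /= xs].
  rewrite ltnn; apply/esym/eqP; rewrite add0n -leqn0 leqNgt -has_count.
  by apply/hasPn => y /alla; rewrite -leqNgt; exact: ltnW.
by rewrite (alla _ xs) (IH (path_sorted as_) xs).
Qed.

Lemma sorted_enum_ord (K : nat) (A : {set 'I_K}) :
  sorted (fun i j : 'I_K => (i < j)%N) (enum A).
Proof.
have tr : transitive (fun i j : 'I_K => (i < j)%N) by move=> ? ? ?; exact: ltn_trans.
rewrite /enum_mem -enumT; apply: sorted_filter => //.
by have := iota_ltn_sorted 0 K; rewrite -val_enum_ord sorted_map.
Qed.

Section FinalArm.
Context {R : realType} {N K : nat}.
Variable assign : forall m, 'M[R]_(m, K) -> ('I_m -> 'I_K).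
Variables (own : 'I_N -> 'I_K) (o : 'I_K -> 'I_K -> nat) (Tb : nat).

Definition others (n : 'I_N) : {set 'I_K} :=
  [set i | (i != own n) && [exists m, own m == i]].

(** The last branch of [doaws_arm], with the own arms and the transmission counts abstracted as
    [own] and [o]. *)
Definition final_arm (n : 'I_N) : 'I_K :=
  assign
    (\matrix_(i < #|others n|.+1, j < K)
       ((o (nth (own n) (enum (own n |: others n)%SET) i) j)%:R / Tb%:R))
    (inord #|[set i in others n | (i < own n)%N]|).

(** The matrix of player [n] has [#|others n|.+1] rows, a number only provably equal to [N]; hence
    the comparison across dimensions, through the values of the ordinals. *)
Lemma eq_assign p q (A : 'M[R]_(p, K)) (B : 'M[R]_(q, K)) (i : 'I_p) (j : 'I_q) :
  p = q -> i = j :> nat ->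
  (forall (i : 'I_p) (j : 'I_q) k, i = j :> nat -> A i k = B j k) ->
  assign A i = assign B j.
Proof.
move=> pq; case: _ / pq in B j * => /val_inj -> AB.
by have -> : A = B by apply/matrixP => i' k; exact: AB.
Qed.

(** All players hold the same matrix [M], and player [n] owns the row [rank n]. Passing from [M] to
    [mu] changes the value of any assignment by at most [N%:R * e]; this is paid once for [pistar]
    and once for the computed assignment. *)
Lemma final_arm_optimal (mu : 'M[R]_(N, K)) (pistar : 'I_N -> 'I_K) (e : R) :
  (0 < N)%N -> injective own ->
  (forall (M : 'M[R]_(N, K)), optimal_assignment M (assign M)) ->
  (forall n k, `|(o (own n) k)%:R / Tb%:R - mu n k| <= e) ->
  optimal_assignment mu pistar ->
  \sum_n mu n (pistar n) - N%:R * (e *+ 2) <= \sum_n mu n (final_arm n).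
Proof.
move=> N0 own_inj assign_opt close [pistar_inj _].
pose U : {set 'I_K} := [set own m | m : 'I_N]%SET.
have cardU : #|U| = N by rewrite card_imset// card_ord.
have ownU n : own n \in U by apply/imsetP; exists n.
have UE n : (own n |: others n)%SET = U.
  apply/setP => i; rewrite !inE; apply/idP/imsetP => [|[m _ ->]].
    by case: eqP => [->|_/= /existsP[m /eqP <-]]; [exists n|exists m].
  by case: eqP => //= _; apply/existsP; exists m.
have cardo n : #|others n|.+1 = N.
  by rewrite -[RHS]cardU -(UE n) cardsU1 !inE eqxx.
have rank_lt n : (index (own n) (enum U) < N)%N.
  by rewrite -[ltnRHS]cardU cardE index_mem mem_enum.
pose rank n : 'I_N := Ordinal (rank_lt n).
have nth_rank x0 n : nth x0 (enum U) (rank n) = own n.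
  by rewrite nth_index// mem_enum.
have rank_inj : injective rank.
  by move=> n m rnm; apply: own_inj; rewrite -(nth_rank (own n)) rnm nth_rank.
pose x0 := own (Ordinal N0).
pose M : 'M[R]_(N, K) := \matrix_(i, j) ((o (nth x0 (enum U) i) j)%:R / Tb%:R).
have finalE n : final_arm n = assign M (rank n).
  apply: eq_assign => //.
    rewrite inordK; last first.
      rewrite ltnS; apply: subset_leq_card; apply/fintype.subsetP => i.
      by rewrite !inE => /andP[].
    rewrite /= index_sorted_count ?mem_enum//; last exact: sorted_enum_ord.
    rewrite -sum1_count big_enum_cond/= sum1_card.
    apply: eq_card => i; rewrite [RHS]unfold_in -(UE n) !inE.
    by case: eqP => //= ->; rewrite ltnn.
  move=> i j k ij; rewrite !mxE UE ij; congr ((o _ _)%:R / _).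
  by apply: set_nth_default; rewrite -cardE cardU.
(* The competitor in the optimality of [assign M] is [pistar] composed with the inverse of [rank],
   which translates players into rows. *)
have [g rankK gK] := injF_bij rank_inj.
have [_ /(_ _ (inj_comp pistar_inj (can_inj gK)))] := assign_opt M.
rewrite (reindex_inj rank_inj) [X in _ <= X -> _](reindex_inj rank_inj)/=.
under eq_bigr do rewrite rankK.
under [X in _ <= X -> _]eq_bigr do rewrite -finalE.
move=> opt.
have lem (rho : 'I_N -> 'I_K) :
    `|\sum_n M (rank n) (rho n) - \sum_n mu n (rho n)| <= N%:R * e.
  rewrite -sumrB (le_trans (ler_norm_sum _ _ _))//.
  rewrite mulr_natl -[X in _ *+ X]card_ord -sumr_const; apply: ler_sum => n _.
  by rewrite mxE nth_rank close.
have := lem pistar; have := lem final_arm; rewrite !ler_norml.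
move: opt; lra.
Qed.

End FinalArm.

(** * Bernoulli signaling *)

Section SignalPatterns.
Context {N K : nat}.
Variables Tr Ts Tb : nat.
Local Notation start := (frame_start K Tr Ts Tb).
Local Notation slot := ('I_N * 'I_K * 'I_Tb)%type.
Implicit Types (f : {ffun slot -> bool}) (n : 'I_N) (j : 'I_K) (u : 'I_Tb).

(** Slot [u] of frame [j] is round [start j + u.+1]; the signal is [false] in all rounds outside the
    frames. *)
Definition signal_of f n t : bool :=
  [exists j : 'I_K, exists u : 'I_Tb, (t == start j + u.+1)%N && f (n, j, u)].

Lemma frame_start_inj j j' u u' :
  (start j + u.+1 = start j' + u'.+1)%N -> j = j' /\ u = u'.
Proof.
rewrite /frame_start !addnS => -[]; rewrite -!addnA => /addnI /addnI.
have Tb0 : (0 < Tb)%N by apply: leq_ltn_trans (ltn_ord u).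
move=> ju; split; apply: val_inj => /=.
  have := congr1 (fun x => x %/ Tb)%N ju.
  by rewrite !divnMDl// !divn_small// !addn0.
have := congr1 (fun x => x %% Tb)%N ju.
by rewrite !modnMDl !modn_small.
Qed.

Lemma signal_ofE f n j u : signal_of f n (start j + u.+1) = f (n, j, u).
Proof.
apply/existsP/idP => [[j' /existsP[u' /andP[/eqP + fu]]]|fu].
  by move=> /frame_start_inj[-> ->].
by exists j; apply/existsP; exists u; rewrite eqxx.
Qed.

Lemma signaling_roundP t :
  signaling_round K Tr Ts Tb t <-> exists j u, t = (start j + u.+1)%N.
Proof.
rewrite /signaling_round /frame_start mul0n addn0; split=> [/andP[t1 t2]|].
  have s_lt : (t.-1 - (Tr + K * Ts) < K * Tb)%N by lia.
  have Tb0 : (0 < Tb)%N by move: s_lt; case: Tb => //; rewrite muln0.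
  have j_lt : ((t.-1 - (Tr + K * Ts)) %/ Tb < K)%N by rewrite ltn_divLR.
  have u_lt : ((t.-1 - (Tr + K * Ts)) %% Tb < Tb)%N by rewrite ltn_mod.
  exists (Ordinal j_lt), (Ordinal u_lt) => /=.
  have := divn_eq (t.-1 - (Tr + K * Ts)) Tb; lia.
move=> [j [u ->]]; have := ltn_ord j; have := ltn_ord u => uT jK.
have : (j.+1 * Tb <= K * Tb)%N by rewrite leq_mul2r jK orbT.
rewrite mulSn; lia.
Qed.

(** A general monoid law covers both the sum in [transmissions] and the product in
    [signal_weight]. *)
Lemma big_frame (A : Type) (idx : A) (op : Monoid.law idx) j (F : nat -> A) :
  \big[op/idx]_((start j).+1 <= t < (start j.+1).+1) F t =
  \big[op/idx]_(u < Tb) F (start j + u.+1)%N.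
Proof.
have -> : (start j.+1 = start j + Tb)%N by rewrite /frame_start mulSn; lia.
rewrite -[X in index_iota X _]add0n big_addn subSS addKn big_mkord.
by apply: eq_bigr => u _; rewrite addnC addSnnS.
Qed.

Definition frame_count f n j : nat := \sum_(u < Tb) f (n, j, u).

(** With distinct arms, a transmission on the arm of [n] can only come from [n]. *)
Lemma transmissions_inj (draw : 'I_N -> nat -> 'I_K) (sig : 'I_N -> nat -> bool)
    f n j :
  injective (own_arm Tr draw) ->
  (forall m t, signaling_round K Tr Ts Tb t -> sig m t = signal_of f m t) ->
  transmissions Tr Ts Tb draw sig (own_arm Tr draw n) j = frame_count f n j.
Proof.
move=> own_inj sigf; rewrite /transmissions big_frame; apply: eq_bigr => u _.
congr nat_of_bool; rewrite -signal_ofE -sigf; last first.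
  by apply/signaling_roundP; exists j, u.
apply/existsP/idP => [[m /andP[/eqP/own_inj ->]]//|su].
by exists n; rewrite eqxx.
Qed.

Section Weight.
Context {R : realType}.
Implicit Types p : 'I_N -> 'I_K -> R.

Definition bernoulli_weight (x : R) (b : bool) : R := if b then x else 1 - x.

Definition pattern_weight p f : R :=
  \prod_(i : slot) bernoulli_weight (p i.1.1 i.1.2) (f i).

Lemma signal_weightE (draw : 'I_N -> nat -> 'I_K)
    (rew : 'I_N -> 'I_K -> nat -> R) f :
  signal_weight Tr Ts Tb draw rew (signal_of f) =
  pattern_weight (local_estimate Tr Ts draw rew) f.
Proof.
rewrite /pattern_weight /signal_weight.
under eq_bigr do under eq_bigr do (rewrite big_frame; under eq_bigr do rewrite signal_ofE).
by rewrite pair_big/= pair_big/=; apply: eq_bigr => -[[n j] u] _.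
Qed.

Lemma bernoulli_weight_ge0 x b : 0 <= x <= 1 -> 0 <= bernoulli_weight x b.
Proof. by case: b => /andP[x0 x1]//=; rewrite subr_ge0. Qed.

Lemma pattern_weight_ge0 p f :
  (forall n j, 0 <= p n j <= 1) -> 0 <= pattern_weight p f.
Proof. by move=> p01; apply: prodr_ge0 => i _; exact: bernoulli_weight_ge0. Qed.

Lemma frame_deviation_le p n j (e : R) :
  (0 < Tb)%N -> (forall n j, 0 <= p n j <= 1) -> 0 <= e ->
  \sum_(f | e < `|(frame_count f n j)%:R / Tb%:R - p n j|) pattern_weight p f
  <= 2 * expR (- (2 * Tb%:R * e ^+ 2)).
Proof.
move=> Tb0 p01 e0.
pose A : {pred slot} := [pred i | i.1 == (n, j)].
have sumA (F : slot -> R) : \sum_(i in A) F i = \sum_u F (n, j, u).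
  rewrite (reindex_onto (fun u => ((n, j), u)) (fun i => i.2)) => [|[nj u] /=].
    by apply: eq_bigl => u; rewrite inE !eqxx.
  by rewrite inE/= => /eqP ->.
have cardA : #|A|%:R = Tb%:R :> R.
  by rewrite -sum1_card natr_sum (sumA (fun=> 1)) sumr_const card_ord.
(* The parameter [s = 4 * e] minimizes [Tb%:R * (s ^+ 2 / 8) - s * (Tb%:R * e)]. *)
have expE : Tb%:R * ((4 * e) ^+ 2 / 8) - 4 * e * (Tb%:R * e) =
    - (2 * Tb%:R * e ^+ 2) :> R by field.
have TbR : 0 < Tb%:R :> R by rewrite ltr0n.
pose w (i : slot) (b : bool) := bernoulli_weight (p i.1.1 i.1.2) b.
have w0 i b : 0 <= w i b by exact: bernoulli_weight_ge0.
have w1 i : \sum_b w i b = 1 by rewrite big_bool/= addrC subrK.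
have s0 : 0 <= 4 * e by rewrite mulr_ge0.
have up := @hoeffding_finite R slot bool A w (fun b => b%:R)
  (fun i => p i.1.1 i.1.2) (4 * e) (Tb%:R * e) w0 w1.
(* The lower tail is the upper tail of the complemented bits, whose means are [1 - p]. *)
have lo := @hoeffding_finite R slot bool A w (fun b => (~~ b)%:R)
  (fun i => 1 - p i.1.1 i.1.2) (4 * e) (Tb%:R * e) w0 w1.
rewrite cardA expE in up lo.
have {}up := up _ _ s0; have {}lo := lo _ _ s0.
rewrite mulrDl !mul1r.
apply: (@le_trans _ _ (\sum_(f : {ffun slot -> bool} |
    Tb%:R * e <= \sum_(i in A) ((f i)%:R - p i.1.1 i.1.2)) pattern_weight p f +
  \sum_(f : {ffun slot -> bool} |
    Tb%:R * e <= \sum_(i in A) ((~~ f i)%:R - (1 - p i.1.1 i.1.2)))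
    pattern_weight p f)); last first.
  apply: lerD; [apply: up|apply: lo].
  - by case; rewrite lexx ler01.
  - move=> i _; rewrite big_bool/= /w /= mulr0 mulr1 addr0 lexx/=.
    by case/andP: (p01 i.1.1 i.1.2).
  - by case; rewrite lexx ler01.
  - move=> i _; rewrite big_bool/= /w /= mulr0 mulr1 add0r lexx/= gerBl.
    by case/andP: (p01 i.1.1 i.1.2).
rewrite big_mkcond [X in _ <= X + _]big_mkcond [X in _ <= _ + X]big_mkcond/=.
rewrite -big_split/=; apply: ler_sum => f _.
have pw0 : 0 <= pattern_weight p f by exact: pattern_weight_ge0.
have -> : \sum_(i in A) ((f i)%:R - p i.1.1 i.1.2) =
    Tb%:R * ((frame_count f n j)%:R / Tb%:R - p n j).
  rewrite sumA/= sumrB sumr_const card_ord -natr_sum mulrBr mulrCA divff ?gt_eqF//.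
  by rewrite mulr1 -[p n j *+ _]mulr_natl.
have -> : \sum_(i in A) ((~~ f i)%:R - (1 - p i.1.1 i.1.2)) =
    Tb%:R * - ((frame_count f n j)%:R / Tb%:R - p n j).
  rewrite sumA/= (eq_bigr (fun u => - ((f (n, j, u))%:R - p n j))); last first.
    by move=> u _; case: (f _) => /=; ring.
  rewrite sumrN sumrB sumr_const card_ord -natr_sum mulrN mulrBr mulrCA divff ?gt_eqF//.
  by rewrite mulr1 -[p n j *+ _]mulr_natl.
rewrite !ler_pM2l// ltr_normr; case: ifPn => [/orP[] /ltW -> /=|_].
- by rewrite lerDl; case: ifP.
- by rewrite lerDr; case: ifP.
- by apply: addr_ge0; case: ifP.
Qed.

End Weight.
End SignalPatterns.

(** * Probabilities of deviations *)

Section Measurability.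
Context {R : realType} {N K : nat} d {T : measurableType d}.

(** The measurable type is arbitrary so that the lemma serves both for the ambient sigma-algebra and
    for [history]; the latter contains the rewards up to round [Tr + K * Ts], hence the bound on
    [t]. *)
Lemma measurable_local_estimate (Tr Ts : nat) (draw : 'I_N -> nat -> 'I_K)
    (X : 'I_N -> 'I_K -> nat -> T -> R) n k : (0 < Ts)%N ->
  (forall n k t, (0 < t <= Tr + K * Ts)%N -> measurable_fun setT (X n k t)) ->
  measurable_fun setT
    (fun w => local_estimate Tr Ts draw (fun n k t => X n k t w) n k).
Proof.
move=> Ts0 mX.
pose g (i : 'I_(K * Ts)) w : R := if i \in visits Tr draw n k then
  obtained Tr draw (fun n k t => X n k t w) n (i + Tr.+1) else 0.
rewrite (_ : (fun w => _) = (fun w => (\sum_i g i w) * Ts%:R^-1)); last first.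
  by apply/funext => w; rewrite local_estimateE// big_mkcond.
apply: measurable_funM => //; apply: measurable_sum => i; rewrite /g /obtained.
case: (_ \in visits _ _ _ _) => //; case: (collision_free _ _) => //; apply: mX.
by have := ltn_ord i; rewrite addnS/=; lia.
Qed.

Lemma measurable_gt_dist (f : T -> R) (x e : R) : measurable_fun setT f ->
  measurable [set w | e < `|x - f w|].
Proof.
move=> mf; rewrite -[X in measurable X]setTI.
have : measurable_fun setT (fun w => e < `|x - f w|).
  apply: measurable_fun_ltr => //.
  by apply: measurableT_comp => //; apply: measurable_funB.
by move=> /(_ measurableT [set true] I).
Qed.

End Measurability.

(** Independence is given for finite subsets of the index type [J]; the image of the injection [g]
    is such a subset. *)
Lemma indep_fin d (T : measurableType d) (R : realType) (P : probability T R)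
    (I : finType) (J : choiceType) (D : set J) (F : J -> set (set T))
    (g : I -> J) (E : I -> set T) :
  mutually_independent P D F -> injective g ->
  (forall i, D (g i) /\ F (g i) (E i)) ->
  P [set w | forall i, E i w] = (\prod_i P (E i))%E.
Proof.
move=> [_ indep] g_inj DF.
pose E' (x : J) := if [pick i | g i == x] is Some i then E i else setT.
have E'g i : E' (g i) = E i.
  rewrite /E'; case: pickP => [j /eqP/g_inj ->//|/(_ i)].
  by rewrite eqxx.
pose s := seq_fset tt (map g (index_enum I)).
have sP x : x \in s -> exists i, x = g i.
  by rewrite seq_fsetE => /mapP[i _ ->]; exists i.
have := indep s E' _; rewrite (perm_big _ (seq_fset_perm _ _))/= undup_id; last first.
  by rewrite map_inj_uniq// index_enum_uniq.
rewrite big_map; under eq_bigr do rewrite E'g.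
move=> <-; last by move=> x /sP[i ->]; rewrite E'g.
congr (P _); apply/seteqP; split=> w /= h => [x /sP[i ->]|i]; first by rewrite E'g.
by rewrite -E'g; apply: h; rewrite /= seq_fsetE map_f// mem_index_enum.
Qed.

Section Model.
Context {R : realType} {d : measure_display} {T : measurableType d}.
Context {P : probability T R} {N K : nat} {mu : 'M[R]_(N, K)}.
Context {S : 'I_N -> 'I_K -> nat -> {RV P >-> R}}.
Variables (draw : 'I_N -> nat -> T -> 'I_K) (sig : 'I_N -> nat -> T -> bool).
Variables (r Ts Tb : nat).
Hypotheses (Ts0 : (0 < Ts)%N) (Tb0 : (0 < Tb)%N).
Hypothesis hS : reward_model mu S.
Local Notation Tr := r.+1.
Hypothesis hrun : doaws_run S draw sig Tr Ts Tb.

Local Notation pattern := {ffun 'I_N * 'I_r.+1 -> 'I_K}.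

Definition draws_are (c : pattern) : set T :=
  [set w | forall i : 'I_N * 'I_r.+1, draw i.1 i.2.+1 w = c i].

Lemma draws_areP c w : draws_are c w ->
  forall n t, (0 < t <= Tr)%N -> draw n t w = pattern_draw c n t.
Proof.
move=> cw n t /andP[t0 tr]; rewrite /pattern_draw -cw /=.
by rewrite inordK ?prednK//; case: t t0 tr.
Qed.

Lemma draws_are_own_arm c w : draws_are c w ->
  own_arm Tr (fun n t => draw n t w) = own_arm Tr (pattern_draw c).
Proof.
move=> /draws_areP cw; apply/funext => n; rewrite /own_arm /hop_arm.
rewrite (@eq_kept _ _ _ (pattern_draw c)); last first.
  by move=> m s /andP[s0 sr]; apply: cw; rewrite s0 ltnW.
by rewrite cw ?leqnn.
Qed.

Lemma draws_are_cover w : exists c, draws_are c w.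
Proof. by exists [ffun i : 'I_N * 'I_r.+1 => draw i.1 i.2.+1 w] => i; rewrite ffunE. Qed.

Lemma draws_are_indep c (Q : set T) : reward_sigma S Q ->
  P (draws_are c `&` Q) = ((K%:R^-1 ^+ (N * Tr))%:E * P Q)%E.
Proof.
move=> mQ.
(* As in [hopping_sources], [None] stands for the rewards and [Some] for a single draw. *)
pose E (x : option ('I_N * 'I_r.+1)) := if x is Some i
  then [set w | draw i.1 i.2.+1 w = c i] else Q.
pose g (x : option ('I_N * 'I_r.+1)) : option ('I_N * nat) :=
  if x is Some i then Some (i.1, i.2.+1) else None.
have g_inj : injective g.
  by move=> [[n s]|] [[m t]|]//= [-> /val_inj ->].
have := indep_fin (E := E) (hop_indep hrun) g_inj.
rewrite (_ : [set w | _] = draws_are c `&` Q); last first.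
  apply/seteqP; split=> [w h|w [cw Qw] [i|]]; [|exact: cw|exact: Qw].
  by split=> [i|]; [exact: (h (Some i))|exact: (h None)].
move=> ->; last first.
  case=> [[n s]|] /=; split=> //.
  by exists [set c (n, s)] => //; rewrite setTI.
rewrite (bigD1 None)//= muleC; congr (_ * _)%E.
rewrite (reindex_omap Some id)/=; last by case.
rewrite (eq_bigl xpredT); last by move=> i; rewrite eqxx.
rewrite (eq_bigr (fun=> (K%:R^-1)%:E)); last first.
  by move=> [n s] _; apply: (hop_unif hrun); exact: ltn_ord.
by rewrite prodEFin prodr_const card_prod !card_ord.
Qed.

Lemma prob_draws_are c : P (draws_are c) = (K%:R^-1 ^+ (N * Tr))%:E.
Proof.
rewrite -[draws_are c]setIT draws_are_indep; last first.
  exact: (@measurableT _ (g_sigma_algebraType _)).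
by rewrite [X in (_ * X)%E]probability_setT mule1.
Qed.


Lemma measurable_fun_generators (G : set (set T)) (X : T -> R) :
  (forall B, measurable B -> G (X @^-1` B)) ->
  measurable_fun (setT : set (g_sigma_algebraType G)) X.
Proof.
move=> GX _ B mB; apply: sub_sigma_algebra; rewrite setTI; exact: GX.
Qed.

Lemma reward_eventsP n k t B : measurable B ->
  reward_events S n k t (S n k t @^-1` B).
Proof. by move=> mB; exists B => //; rewrite setTI. Qed.

Lemma draw_eventsP n t k : draw_events draw n t [set w | draw n t w = k].
Proof. by exists [set k] => //; rewrite setTI. Qed.

Lemma draws_areE c : draws_are c =
  \bigcap_(i in [set: 'I_N * 'I_r.+1]) [set w | draw i.1 i.2.+1 w = c i].
Proof. by apply/seteqP; split=> w h i; [move=> _|]; exact: h. Qed.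

Lemma measurable_draws_are c : measurable (draws_are c).
Proof.
rewrite draws_areE; apply: fin_bigcap_measurable => // i _.
apply: ((hop_indep hrun).1 (Some (i.1, i.2.+1))); first exact: ltn_ord.
exact: draw_eventsP.
Qed.

Definition signals_are (f : {ffun 'I_N * 'I_K * 'I_Tb -> bool}) : set T :=
  [set w | forall n t, signaling_round K Tr Ts Tb t ->
     sig n t w = signal_of Tr Ts f n t].

Lemma signals_are_cover w : exists f, signals_are f w.
Proof.
exists [ffun i : 'I_N * 'I_K * 'I_Tb =>
  sig i.1.1 (frame_start K Tr Ts Tb i.1.2 + i.2.+1) w].
move=> n t /signaling_roundP[j [u ->]].
by rewrite signal_ofE ffunE.
Qed.

Lemma measurable_signals_are f : measurable (signals_are f).
Proof.
rewrite (_ : signals_are f = \bigcap_(i in [set: 'I_N * 'I_K * 'I_Tb])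
    (sig i.1.1 (frame_start K Tr Ts Tb i.1.2 + i.2.+1) @^-1` [set f i])); last first.
  apply/seteqP; split=> w h.
    move=> [[n j] u] _ /=; rewrite h ?signal_ofE//.
    by apply/signaling_roundP; exists j, u.
  move=> n t /signaling_roundP[j [u ->]]; rewrite signal_ofE.
  exact: (h (n, j, u)).
apply: fin_bigcap_measurable => // -[[n j] u] _ /=.
rewrite -[X in measurable X]setTI; apply: (sig_meas hrun) => //.
by apply/signaling_roundP; exists j, u.
Qed.

(** Freezing the draws at [c] leaves a function of the rewards alone, defined on the whole space; it
    agrees with the true estimates on [draws_are c]. *)
Definition estimate_for (c : pattern) (w : T) : 'I_N -> 'I_K -> R :=
  local_estimate Tr Ts (pattern_draw c) (fun n k t => S n k t w).

Lemma estimate_for_ge0_le1 c w n k : 0 <= estimate_for c w n k <= 1.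
Proof.
apply: local_estimate_ge0_le1 => // m l t t0; exact: (rew_range hS).
Qed.

Lemma draws_are_local_estimate c w : draws_are c w ->
  local_estimate Tr Ts (fun n t => draw n t w) (fun n k t => S n k t w) =
  estimate_for c w.
Proof.
move=> cw; rewrite /estimate_for; apply/funext => n; apply/funext => k.
by rewrite /local_estimate /obtained /cyclic_arm (draws_are_own_arm cw).
Qed.

Lemma measurable_estimate_for c n k :
  measurable_fun setT (fun w => estimate_for c w n k).
Proof. exact: measurable_local_estimate. Qed.

(** The signals are frozen at [f], so the event concerns only the first two phases and can enter the
    event [H] of [sig_law]. *)
Definition signal_deviation c n j (e : R)
    (f : {ffun 'I_N * 'I_K * 'I_Tb -> bool}) : set T :=
  [set w | e < `|(frame_count f n j)%:R / Tb%:R - estimate_for c w n j|].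

Lemma measurable_signal_deviation c n j e f :
  measurable (signal_deviation c n j e f).
Proof. exact/measurable_gt_dist/measurable_estimate_for. Qed.

Lemma history_signal_deviation c n j e f :
  history S draw Tr Ts (draws_are c `&` signal_deviation c n j e f).
Proof.
rewrite /history; set G := (X in <<s X>>).
apply: (@measurableI _ (g_sigma_algebraType G)).
  rewrite draws_areE.
  apply: (@fin_bigcap_measurable _ (g_sigma_algebraType G)) => // i _.
  apply: sub_sigma_algebra; right; exists (i.1, i.2.+1) => /=.
    exact: ltn_ord.
  exact: draw_eventsP.
apply: (@measurable_gt_dist _ _ (g_sigma_algebraType G)).
apply: (@measurable_local_estimate _ _ _ _ (g_sigma_algebraType G)) => // m k t t0.
apply: measurable_fun_generators => B mB; left.
by exists (m, k, t) => //; exact: reward_eventsP.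
Qed.

(** [sig_law] turns each term into an integral of pattern weights. Once sum and integral are
    exchanged, the integrand at a fixed outcome is the total weight of the deviating patterns,
    bounded by [frame_deviation_le]. *)
Lemma signal_deviation_le c n j (e : R) : 0 <= e ->
  (\sum_f P ((draws_are c `&` signal_deviation c n j e f) `&` signals_are f) <=
   (K%:R^-1 ^+ (N * Tr) * (2 * expR (- (2 * Tb%:R * e ^+ 2))))%:E)%E.
Proof.
move=> e0.
have mD := measurable_draws_are c.
have mH f : measurable (signal_deviation c n j e f).
  exact: measurable_signal_deviation.
pose W (f : {ffun 'I_N * 'I_K * 'I_Tb -> bool}) w : R := pattern_weight (estimate_for c w) f.
have mW f : measurable_fun setT (W f).
  apply: measurable_prod => i _; rewrite /bernoulli_weight.
  case: (f i); first exact: measurable_estimate_for.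
  by apply: measurable_funB => //; exact: measurable_estimate_for.
have W0 f w : 0 <= W f w.
  by apply: pattern_weight_ge0 => *; exact: estimate_for_ge0_le1.
(* Extending by 0 moves the dependence on [f] from the domain to the integrand, so all integrals run
   over [draws_are c]. *)
pose V f w : R := if e < `|(frame_count f n j)%:R / Tb%:R - estimate_for c w n j|
  then W f w else 0.
have VE f : (fun w => (V f w)%:E) = (EFin \o W f) \_ (signal_deviation c n j e f).
  apply/funext => w; rewrite patchE /V; case: ifPn => [h|h].
    by rewrite mem_set.
  by rewrite memNset//; apply/negP.
have mV f : measurable_fun setT (fun w => (V f w)%:E).
  rewrite VE; apply/(measurable_restrictT _ (mH f)).
  by apply: measurable_funTS; apply/measurable_EFinP.
have V0 f w : (0 <= (V f w)%:E)%E by rewrite lee_fin /V; case: ifP.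
rewrite (eq_bigr (fun f => \int[P]_(w in draws_are c) (V f w)%:E)%E); last first.
  move=> f _; rewrite (sig_law hrun (signal_of Tr Ts f)); last first.
    exact: history_signal_deviation.
  rewrite [in RHS]VE -integral_mkcondr; apply: eq_integral => w; rewrite inE => -[cw _] /=.
  by rewrite signal_weightE (draws_are_local_estimate cw).
rewrite -ge0_integral_sum//; last by move=> f; apply: measurable_funTS.
apply: (@le_trans _ _ (\int[P]_(w in draws_are c)
    cst (2 * expR (- (2 * Tb%:R * e ^+ 2)))%:E w)%E).
  apply: ge0_le_integral => //.
  - by move=> w _; apply: sume_ge0.
  - by apply: emeasurable_sum => f; apply: measurable_funTS.
  move=> w _; rewrite sumEFin lee_fin -big_mkcond/=.
  by apply: frame_deviation_le => // *; exact: estimate_for_ge0_le1.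
by rewrite integral_cst// [X in (_ * X)%E]prob_draws_are -EFinM mulrC.
Qed.

(** Stated with the raw average, which equals [estimate_for] when the own arms under [c] are
    distinct. *)
Definition reward_deviation (c : pattern) n k (e : R) : set T :=
  [set w | e < `|mu n k - (\sum_(i in visits (Ts := Ts) Tr (pattern_draw c) n k)
                             S n k (i + Tr.+1)%N w) / Ts%:R|].

Lemma reward_deviationE c n k e :
  reward_deviation c n k e = [set w | e < `|mu n k -
    (fun w => (\sum_(i <- enum (visits (Ts := Ts) Tr (pattern_draw c) n k))
       S n k (i + Tr.+1)%N w) * Ts%:R^-1) w|].
Proof. by apply/seteqP; split=> w; rewrite /reward_deviation/= big_enum. Qed.

Lemma measurable_reward_deviation c n k e :
  measurable (reward_deviation c n k e).
Proof.
rewrite reward_deviationE; apply: measurable_gt_dist.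
by apply: measurable_funM => //; apply: measurable_sum => i.
Qed.

Lemma integrable_reward n k t : (0 < t)%N ->
  P.-integrable setT (EFin \o S n k t).
Proof.
move=> t0; apply: measurable_bounded_integrable => //.
  by rewrite [X in (X < _)%E]probability_setT ltry.
exists 1; split => // x x1 w _ /=; apply: le_trans (ltW x1).
by case/andP: (rew_range hS n k w t0) => ? ?; rewrite ger0_norm.
Qed.

Lemma integral_reward n k t : (0 < t)%N ->
  (\int[P]_w (S n k t w)%:E = (mu n k)%:E)%E.
Proof. by move=> t0; rewrite -(rew_mean hS n k t0) unlock. Qed.

Lemma integral_one_minus_reward n k t : (0 < t)%N ->
  (\int[P]_w (1 - S n k t w)%:E = (1 - mu n k)%:E)%E.
Proof.
move=> t0; rewrite EFinB -(integral_reward n k t0).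
rewrite -[X in (X - _)%E](_ : \int[P]_w (cst 1%:E w) = _)%E; last first.
  by rewrite integral_cst// mul1e; exact: probability_setT.
rewrite -integralB//; last exact: integrable_reward.
by apply: finite_measure_integrable_cst.
Qed.

Lemma mean_ge0_le1 n k : 0 <= mu n k <= 1.
Proof.
apply/andP; split; [|rewrite -subr_ge0]; rewrite -lee_fin.
  rewrite -(integral_reward n k (ltn0Sn 0)); apply: integral_ge0 => w _.
  by rewrite lee_fin; case/andP: (rew_range hS n k w (ltn0Sn 0)).
rewrite -(integral_one_minus_reward n k (ltn0Sn 0)); apply: integral_ge0 => w _.
by rewrite lee_fin subr_ge0; case/andP: (rew_range hS n k w (ltn0Sn 0)).
Qed.

Lemma indep_rewards n k (B : 'I_(K * Ts) -> set R) :
  (forall i, measurable (B i)) ->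
  P [set w | forall i : 'I_(K * Ts), B i (S n k (i + Tr.+1)%N w)] =
  (\prod_(i < K * Ts) P (S n k (i + Tr.+1)%N @^-1` B i))%E.
Proof.
move=> mB.
apply: (indep_fin (E := fun i : 'I_(K * Ts) => S n k (i + Tr.+1)%N @^-1` B i)
  (g := fun i : 'I_(K * Ts) => (k, (i + Tr.+1)%N)) (rew_indep hS n)).
- by move=> i j [] /addIn /val_inj.
- by move=> i /=; split; [rewrite addnS|exact: reward_eventsP].
Qed.

(** For a fixed [c] the averaged rounds are fixed, so the event belongs to [reward_sigma] and the
    probability of the draws splits off. Hoeffding's inequality then applies to the rewards for one
    tail and to one minus the rewards for the other. *)
Lemma reward_deviation_le c n k (e : R) : 0 <= e ->
  (P (draws_are c `&` reward_deviation c n k e) <=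
   (K%:R^-1 ^+ (N * Tr) * (2 * expR (- (2 * Ts%:R * e ^+ 2))))%:E)%E.
Proof.
move=> e0; set Q := reward_deviation c n k e.
have mQ : reward_sigma S Q.
  rewrite /Q reward_deviationE /reward_sigma; set G := (X in <<s X>>).
  apply: (@measurable_gt_dist _ _ (g_sigma_algebraType G)).
  apply: measurable_funM => //; apply: measurable_sum => i.
  apply: measurable_fun_generators => B mB.
  by exists (n, k, (i + Tr.+1)%N); [rewrite /= addnS|exact: reward_eventsP].
have mQ' : measurable Q by exact: measurable_reward_deviation.
rewrite draws_are_indep// EFinM lee_wpmul2l ?lee_fin ?exprn_ge0 ?invr_ge0//.
pose A := visits (Ts := Ts) Tr (pattern_draw c) n k.
pose X (i : 'I_(K * Ts)) w := S n k (i + Tr.+1)%N w.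
have t0 (i : 'I_(K * Ts)) : (0 < i + Tr.+1)%N by rewrite addnS.
have X01 i w : 0 <= X i w <= 1 by exact: (rew_range hS).
have TsR : 0 < Ts%:R :> R by rewrite ltr0n.
have /andP[mu0 mu1] := mean_ge0_le1 n k.
have s0 : 0 <= 4 * e by rewrite mulr_ge0.
have expE : Ts%:R * ((4 * e) ^+ 2 / 8) - 4 * e * (Ts%:R * e) =
    - (2 * Ts%:R * e ^+ 2) :> R by field.
have mX i : measurable_fun setT (X i) by [].
have up := @hoeffding_upper_tail _ T R P _ A X (mu n k) (4 * e) (Ts%:R * e) mX X01.
have lo := @hoeffding_upper_tail _ T R P _ A (fun i w => 1 - X i w)
   (1 - mu n k) (4 * e) (Ts%:R * e).
rewrite card_visits expE in up lo.
set U := [set w | _] in up; set L := [set w | _] in lo.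
have mU : measurable U.
  rewrite /U (_ : [set _ | _] = [set w | Ts%:R * e <= \sum_(i <- enum A) (X i w - mu n k)]).
    rewrite -[X in measurable X]setTI; apply: measurable_fun_le => //.
    by apply: measurable_sum => i; apply: measurable_funB.
  by apply/seteqP; split=> w /=; rewrite big_enum.
have mL : measurable L.
  rewrite /L (_ : [set _ | _] = [set w | Ts%:R * e <= \sum_(i <- enum A) (1 - X i w - (1 - mu n k))]).
    rewrite -[X in measurable X]setTI; apply: measurable_fun_le => //.
    by apply: measurable_sum => i; apply: measurable_funB => //; apply: measurable_funB.
  by apply/seteqP; split=> w /=; rewrite big_enum.
apply: (@le_trans _ _ (P (U `|` L))).
  apply: le_measure; rewrite ?inE//; first exact: measurableU.
  move=> w; rewrite /Q /reward_deviation/= -/A => eQ.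
  have sumE : \sum_(i in A) (X i w - mu n k) =
      Ts%:R * - (mu n k - (\sum_(i in A) X i w) / Ts%:R).
    rewrite sumrB sumr_const card_visits opprB mulrBr mulrCA divff ?gt_eqF//.
    by rewrite mulr1 -[_ *+ Ts]mulr_natl.
  have sumE' : \sum_(i in A) (1 - X i w - (1 - mu n k)) =
      Ts%:R * (mu n k - (\sum_(i in A) X i w) / Ts%:R).
    rewrite -[RHS]opprK -mulrN -sumE -sumrN; apply: eq_bigr => i _; ring.
  move: eQ; rewrite /U /L /= sumE sumE' !ler_pM2l// ltr_normr.
  by case/orP => /ltW; [right|left].
rewrite (le_trans (measureU2 _ _ _))// mulrDl !mul1r EFinD leeD//.
- apply: up => //; first by move=> i; rewrite integral_reward.
  by move=> B mB; exact: indep_rewards.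
- apply: lo => //.
  + by move=> i; apply: measurable_funB.
  + by move=> i w; case/andP: (X01 i w) => ? ?; rewrite subr_ge0 gerBl; apply/andP.
  + by move=> i; rewrite integral_one_minus_reward.
  + by rewrite gerBl.
  + move=> B mB.
    have := @indep_rewards n k (fun i => (fun x => 1 - x) @^-1` B i).
    apply => i; rewrite -[X in measurable X]setTI.
    have m1 : measurable_fun [set: R] (fun x : R => 1 - x).
      by apply: measurable_funB.
    by apply: m1.
Qed.

End Model.

(** * Probability of success *)

(** Positivity of [x] makes the absolute value in [nat_ceil] harmless. *)
Lemma nat_ceil_bounds (R : realType) (x : R) : 0 < x ->
  (0 < nat_ceil x)%N /\ x <= (nat_ceil x)%:R.
Proof.
move=> x0; have c0 : (0 < Num.ceil x)%R by rewrite ceil_gt_int.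
have xc : x <= (nat_ceil x)%:R.
  by rewrite /nat_ceil natr_absz gtr0_norm// Num.Theory.ceil_ge.
by split=> //; rewrite -(ltr_nat R); exact: lt_le_trans xc.
Qed.

(** The choice of [Tr] gives the bound for the base 1 - 1/(4K), which dominates 1 - 1/K; dividing by
    its negative logarithm reverses the inequality. *)
Lemma hopping_rounds_le (R : realType) (K : nat) (delta : R) :
  (0 < K)%N -> 0 < delta < 1 ->
  let Tr := nat_ceil (ln (delta / (3 * K%:R)) / ln (1 - 1 / (4 * K%:R))) in
  (0 < Tr)%N /\ (1 - K%:R^-1) ^+ Tr <= delta / (3 * K%:R).
Proof.
move=> K0 /andP[d0 d1] Tr.
have K1 : 1 <= K%:R :> R by rewrite ler1n.
have KR : 0 < K%:R :> R by rewrite ltr0n.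
set x : R := 1 - 1 / (4 * K%:R).
have q0 : 0 < 1 / (4 * K%:R) :> R by rewrite divr_gt0// mulr_gt0.
have q1 : 1 / (4 * K%:R) <= K%:R^-1 :> R.
  by rewrite div1r lef_pV2 ?posrE ?mulr_gt0//; lra.
have q2 : 1 / (4 * K%:R) < 1 :> R.
  by rewrite ltr_pdivrMr ?mulr_gt0// mul1r; lra.
have lnx : ln x < 0 by apply: ln_lt0; rewrite /x; lra.
have y0 : 0 < delta / (3 * K%:R) by rewrite divr_gt0// mulr_gt0.
have lny : ln (delta / (3 * K%:R)) < 0.
  by apply: ln_lt0; rewrite y0/= ltr_pdivrMr ?mulr_gt0// mul1r; lra.
have [Tr0 Trge] := @nat_ceil_bounds R (ln (delta / (3 * K%:R)) / ln x)
  (ltac:(by rewrite -mulrNN -invrN divr_gt0// oppr_gt0)).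
split=> //.
apply: (@le_trans _ _ (x ^+ Tr)).
  by rewrite lerXn2r ?nnegrE ?subr_ge0 ?invf_le1// /x; lra.
have x0 : 0 < x by rewrite /x; lra.
rewrite -[x in x ^+ _]lnK ?posrE// -expRM_natl -[leRHS]lnK ?posrE// ler_expR.
by rewrite -ler_ndivrMr.
Qed.

(** The constant 8 is chosen so that 2 (8 N^2 / eps^2) (eps / (4 N))^2 = 1, which makes the exponent
    at most [- ln y]. *)
Lemma sampling_rounds_le (R : realType) (N : nat) (eps y : R) :
  (0 < N)%N -> 0 < eps -> 1 < y ->
  let T := nat_ceil (8 * N%:R ^+ 2 / eps ^+ 2 * ln y) in
  (0 < T)%N /\ 2 * expR (- (2 * T%:R * (eps / (4 * N%:R)) ^+ 2)) <= 2 / y.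
Proof.
move=> N0 e0 y1 T.
have NR : 0 < N%:R :> R by rewrite ltr0n.
have lny : 0 < ln y by exact: ln_gt0.
have [T0 Tge] := @nat_ceil_bounds R (8 * N%:R ^+ 2 / eps ^+ 2 * ln y)
  (ltac:(by rewrite mulr_gt0// divr_gt0 ?exprn_gt0// mulr_gt0 ?exprn_gt0)).
split=> //; rewrite ler_pM2l// -[y in leRHS]lnK ?posrE; last by lra.
rewrite -expRN ler_expR lerN2.
have -> : ln y = 2 * (8 * N%:R ^+ 2 / eps ^+ 2 * ln y) * (eps / (4 * N%:R)) ^+ 2.
  by field; rewrite !gt_eqF.
by rewrite ler_pM2r ?exprn_gt0 ?divr_gt0 ?mulr_gt0// ler_pM2l.
Qed.

Lemma eq_transmissions (N K Tr Ts Tb : nat) (draw draw' : 'I_N -> nat -> 'I_K)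
    (sig sig' : 'I_N -> nat -> bool) :
  own_arm Tr draw = own_arm Tr draw' ->
  (forall n t, signaling_round K Tr Ts Tb t -> sig n t = sig' n t) ->
  transmissions Tr Ts Tb draw sig = transmissions Tr Ts Tb draw' sig'.
Proof.
move=> own_eq sig_eq; apply/funext => i; apply/funext => j.
rewrite /transmissions own_eq !big_frame; apply: eq_bigr => u _.
congr nat_of_bool; apply: eq_existsb => n; rewrite sig_eq//.
by apply/signaling_roundP; exists j, u.
Qed.

Section Conclusion.
Context {R : realType} {d : measure_display} {T : measurableType d}.
Context {P : probability T R} {N K : nat} {mu : 'M[R]_(N, K)}.
Context {S : 'I_N -> 'I_K -> nat -> {RV P >-> R}}.
Context {draw : 'I_N -> nat -> T -> 'I_K} {sig : 'I_N -> nat -> T -> bool}.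
Context {r Ts Tb : nat}.
Hypotheses (N0 : (0 < N)%N) (NK : (N <= K)%N).
Hypotheses (Ts0 : (0 < Ts)%N) (Tb0 : (0 < Tb)%N).
Hypothesis hS : reward_model mu S.
Local Notation Tr := r.+1.
Hypothesis hrun : doaws_run S draw sig Tr Ts Tb.
Variable assign : forall m, 'M[R]_(m, K) -> ('I_m -> 'I_K).
Hypothesis hassign : forall m (M : 'M[R]_(m, K)), (m <= K)%N ->
  optimal_assignment M (@assign m M).
Variables (eps delta : R) (pistar : 'I_N -> 'I_K) (t : nat).
Hypothesis t_late : (Tr + K * Ts + K * Tb < t)%N.
Hypothesis pistar_opt : optimal_assignment mu pistar.
Hypothesis eps0 : 0 < eps.
Local Notation e := (eps / (4 * N%:R)).
Hypothesis hTr : (1 - K%:R^-1) ^+ Tr <= delta / (3 * K%:R).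
Hypothesis hTs : 2 * expR (- (2 * Ts%:R * e ^+ 2)) <= delta / (3 * N%:R * K%:R).
Hypothesis hTb : 2 * expR (- (2 * Tb%:R * e ^+ 2)) <= delta / (3 * K%:R ^+ 2).

Local Notation pattern := {ffun 'I_N * 'I_r.+1 -> 'I_K}.
Local Notation signals := {ffun 'I_N * 'I_K * 'I_Tb -> bool}.
Implicit Types (c : pattern) (f : signals).

Definition pattern_arm c f : 'I_N -> 'I_K :=
  final_arm assign (own_arm Tr (pattern_draw c))
    (transmissions Tr Ts Tb (pattern_draw c) (signal_of Tr Ts f)) Tb.

Definition arm (n : 'I_N) (w : T) : 'I_K :=
  doaws_arm Tr Ts Tb assign (fun m s => draw m s w) (fun m s => sig m s w) n t.

Lemma arm_pattern c f w : draws_are draw c w -> signals_are sig r Ts f w ->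
  forall n, arm n w = pattern_arm c f n.
Proof.
move=> cw fw n; rewrite /arm /doaws_arm !ifF; try by apply/negbTE; lia.
rewrite /pattern_arm -(draws_are_own_arm cw).
rewrite -(@eq_transmissions _ _ Tr Ts Tb (fun m s => draw m s w) _
  (fun m s => sig m s w))//; exact: draws_are_own_arm.
Qed.

Definition good (a : 'I_N -> 'I_K) : bool :=
  \sum_n mu n (pistar n) - eps <= \sum_n mu n (a n).

Definition success : set T := [set w | good (fun n => arm n w)].

(** [assign] is an arbitrary function of a real matrix; measurability comes from the arms being
    constant on each of finitely many pairs of patterns. *)
Lemma measurable_success : measurable success.
Proof.
rewrite (_ : success = \big[setU/set0]_(cf : pattern * signals |
    good (pattern_arm cf.1 cf.2))
    (draws_are draw cf.1 `&` signals_are sig r Ts cf.2)).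
  apply: bigsetU_measurable => cf _; apply: measurableI.
    exact: measurable_draws_are hrun _.
  exact: measurable_signals_are hrun _.
have armE c f w : draws_are draw c w -> signals_are sig r Ts f w ->
    (fun n => arm n w) = pattern_arm c f.
  by move=> cw fw; apply/funext => n; exact: arm_pattern.
apply/seteqP; split=> w.
  rewrite /success/= => gw.
  have [c cw] := draws_are_cover draw r w.
  have [f fw] := signals_are_cover (K := K) sig r Ts Tb w.
  by apply/bigsetUP; exists (c, f) => //=; rewrite -(armE _ _ _ cw fw).
move=> /bigsetUP[[c f] /= gcf [cw fw]].
by rewrite /success/= (armE _ _ _ cw fw).
Qed.

Definition all_kept c : bool := [forall n, kept (pattern_draw c) Tr n != None].

(** Own arms are distinct, so the estimates are plain averages of rewards and the counts on the arm
    of [n] are her own signals. Two errors of at most [e] then place each entry within [e *+ 2] of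
    the mean. *)
Lemma failure_of_deviation c f w : all_kept c ->
  draws_are draw c w -> signals_are sig r Ts f w -> ~ success w ->
  (exists n k, reward_deviation (mu := mu) (S := S) Ts c n k e w) \/
  (exists n j, signal_deviation (S := S) Ts c n j e f w).
Proof.
move=> /forallP kc cw fw; apply: contra_notP => /not_orP[nrew nsig].
have NR : 0 < N%:R :> R by rewrite ltr0n.
have own_inj : injective (own_arm Tr (pattern_draw c)) by exact: own_arm_inj.
rewrite /success/= (_ : (fun n => arm n w) = pattern_arm c f) /good; last first.
  by apply/funext => n; exact: arm_pattern.
(* [final_arm_optimal] doubles the entry error [e *+ 2] and multiplies it by [N]; hence the 4 in
   [e]. *)
have -> : eps = N%:R * ((e *+ 2) *+ 2) by rewrite -mulrnA -mulr_natl; field; rewrite gt_eqF.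
apply: final_arm_optimal => // [M|n k]; first exact: hassign.
rewrite (@transmissions_inj _ _ _ _ _ _ _ f)//.
have hr : `|mu n k - estimate_for (S := S) Ts c w n k| <= e.
  rewrite leNgt; apply/negP => h; apply: nrew; exists n, k.
  by move: h; rewrite /estimate_for local_estimate_inj.
have hs : `|(frame_count f n k)%:R / Tb%:R - estimate_for (S := S) Ts c w n k| <= e.
  by rewrite leNgt; apply/negP => h; apply: nsig; exists n, k.
have -> : (frame_count f n k)%:R / Tb%:R - mu n k =
  ((frame_count f n k)%:R / Tb%:R - estimate_for (S := S) Ts c w n k)
  - (mu n k - estimate_for (S := S) Ts c w n k) by ring.
by rewrite (le_trans (ler_normB _ _))// mulr2n lerD.
Qed.

Local Notation kappa := (K%:R^-1 ^+ (N * Tr) : R).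

(** [kappa] is the probability of one draw pattern, so this bounds the conditional probability of
    failure by [2 * delta / 3]. *)
Lemma prob_failure_all_kept c : all_kept c ->
  (P (draws_are draw c `&` ~` success) <= (kappa * (2 * delta / 3))%:E)%E.
Proof.
move=> kc.
have mD := measurable_draws_are hrun c.
have NR : 0 < N%:R :> R by rewrite ltr0n.
have KR : 0 < K%:R :> R by rewrite ltr0n (leq_trans N0).
have kappa0 : 0 <= kappa by rewrite exprn_ge0// invr_ge0.
have e0 : 0 <= e by rewrite divr_ge0 ?mulr_ge0 ?ltW.
(* Signal deviations are also indexed by the pattern [f], on which the event depends. *)
pose F (i : 'I_N * 'I_K + ('I_N * 'I_K) * signals) : set T :=
  match i with
  | inl nk => draws_are draw c `&`
      reward_deviation (mu := mu) (S := S) Ts c nk.1 nk.2 e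
  | inr njf => (draws_are draw c `&`
      signal_deviation (S := S) Ts c njf.1.1 njf.1.2 e njf.2) `&`
      signals_are sig r Ts njf.2
  end.
have mF i : measurable (F i).
  case: i => [nk|njf] /=.
    apply: measurableI => //; exact: measurable_reward_deviation.
  apply: measurableI; last exact: measurable_signals_are hrun _.
  apply: measurableI => //; exact: measurable_signal_deviation.
apply: (@le_trans _ _ (\sum_i P (F i))%E).
  apply: measure_le_fin_cover => //.
    by apply: measurableI => //; apply: measurableC; exact: measurable_success.
  move=> w [cw nw].
  have [f fw] := signals_are_cover (K := K) sig r Ts Tb w.
  have [[n [k h]]|[n [j h]]] := failure_of_deviation kc cw fw nw.
    by exists (inl (n, k)).
  by exists (inr ((n, j), f)).
rewrite big_sumType/=.
apply: (@le_trans _ _ ((kappa * (delta / 3))%:E + (kappa * (delta / 3))%:E)%E); last first.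
  by rewrite -EFinD lee_fin -mulrDr -mulrDl -mulr2n mulr_natl.
apply: leeD.
  apply: (@le_trans _ _ (\sum_(nk : 'I_N * 'I_K) (kappa * (delta / (3 * N%:R * K%:R)))%:E)%E).
    apply: lee_sum => -[n k] _ /=; apply: le_trans (reward_deviation_le Ts0 hS hrun _ _ _ e0) _.
    by rewrite lee_fin ler_wpM2l.
  rewrite sumEFin lee_fin sumr_const card_prod !card_ord -mulrnAr.
  rewrite ler_wpM2l// -mulr_natl natrM le_eqVlt; apply/orP; left.
  by apply/eqP; field; rewrite !gt_eqF.
rewrite -(pair_bigA _ (fun nj f => P (F (inr (nj, f)))))/=.
apply: (@le_trans _ _ (\sum_(nk : 'I_N * 'I_K) (kappa * (delta / (3 * K%:R ^+ 2)))%:E)%E).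
  apply: lee_sum => -[n j] _ /=; apply: le_trans (signal_deviation_le Ts0 Tb0 hS hrun _ _ _ e0) _.
  by rewrite lee_fin ler_wpM2l.
rewrite sumEFin lee_fin sumr_const card_prod !card_ord -mulrnAr.
rewrite ler_wpM2l// -mulr_natl natrM.
have delta0 : 0 <= delta / (3 * K%:R ^+ 2).
  by apply: le_trans hTb; rewrite mulr_ge0// expR_ge0.
(* The [N * K] pairs of a player and a frame number at most [K * K], in accordance with the square
   in [Tb]. *)
apply: (@le_trans _ _ (K%:R * K%:R * (delta / (3 * K%:R ^+ 2)))).
  by rewrite ler_wpM2r// ler_wpM2r ?(ltW KR)// ler_nat.
by rewrite le_eqVlt; apply/orP; left; apply/eqP; field; rewrite !gt_eqF.
Qed.

(** A union bound over the players; for each of them [card_not_kept] counts the equally likely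
    patterns, and [N <= K] absorbs the number of players. *)
Lemma sum_not_all_kept : \sum_(c | ~~ all_kept c) kappa <= delta / 3.
Proof.
have KR : 0 < K%:R :> R by rewrite ltr0n (leq_trans N0).
have K0 : (0 < K)%N by rewrite (leq_trans N0).
have NK' : N%:R <= K%:R :> R by rewrite ler_nat.
have kappa0 : 0 <= kappa by rewrite exprn_ge0// invr_ge0.
apply: (@le_trans _ _ (\sum_(n < N) \sum_(c : pattern | kept (pattern_draw c) Tr n == None) kappa)).
  rewrite (exchange_big_dep xpredT)//= [leLHS]big_mkcond/=; apply: ler_sum => c _.
  case: ifPn => [|_]; last by apply: sumr_ge0.
  move=> /forallPn[n]; rewrite negbK => nk.
  by rewrite (bigD1 n)//= lerDl; apply: sumr_ge0.
apply: (@le_trans _ _ (\sum_(n < N) (delta / (3 * K%:R)))).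
  apply: ler_sum => n _; apply: le_trans hTr.
  rewrite sumr_const -[_ *+ #|_|]mulr_natl.
  have := card_not_kept n NK (leqnn r.+1).
  rewrite cardsE -(ler_nat R) !natrM !natrX => h.
  rewrite exprVn ler_pdivrMr ?exprn_gt0//.
  rewrite (_ : 1 - K%:R^-1 = K.-1%:R / K%:R); last first.
    by rewrite -subn1 natrB// mulrBl divff ?gt_eqF// mul1r.
  by rewrite expr_div_n mulrAC ler_pdivlMr ?exprn_gt0.
rewrite sumr_const card_ord -[_ *+ N]mulr_natl.
have delta0 : 0 <= delta / (3 * K%:R).
  by apply: le_trans hTr; rewrite exprn_ge0// subr_ge0 invf_le1// ler1n.
apply: (@le_trans _ _ (K%:R * (delta / (3 * K%:R)))); first by rewrite ler_wpM2r.
by rewrite le_eqVlt; apply/orP; left; apply/eqP; field; rewrite !gt_eqF.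
Qed.

Lemma prob_success : ((1 - delta)%:E <= P success)%E.
Proof.
have mS := measurable_success.
have KR : 0 < K%:R :> R by rewrite ltr0n (leq_trans N0).
have kappa0 : 0 <= kappa by rewrite exprn_ge0// invr_ge0.
have delta0 : 0 <= 2 * delta / 3.
  have : 0 <= delta / 3 by apply: le_trans sum_not_all_kept; exact: sumr_ge0.
  lra.
suff : (P (~` success) <= delta%:E)%E.
  rewrite probability_setC// EFinB => h.
  have fS : P success \is a fin_num by apply: fin_num_measure.
  by rewrite -(fineK fS) -?EFinB !lee_fin in h *; lra.
apply: (@le_trans _ _ (\sum_c P (draws_are draw c `&` ~` success))%E).
  apply: measure_le_fin_cover.
  - exact: measurableC.
  - move=> c _; apply: measurableI; [exact: measurable_draws_are hrun c|exact: measurableC].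
  - by move=> w nw; have [c cw] := draws_are_cover draw r w; exists c.
(* A pattern leaving some player without an arm is charged its whole probability. The other bound is
   charged to every pattern, and sums to [2 * delta / 3] because there are [K ^ (N * Tr)] patterns
   of probability [kappa]. *)
apply: (@le_trans _ _ (\sum_c ((if ~~ all_kept c then kappa else 0) + kappa * (2 * delta / 3))%:E)%E).
  apply: lee_sum => c _; case: ifPn => [_|/negbNE kc].
    apply: (@le_trans _ _ kappa%:E); last by rewrite lee_fin lerDl mulr_ge0.
    rewrite -(prob_draws_are hrun c); apply: le_measure; rewrite ?inE.
    - by apply: measurableI; [exact: measurable_draws_are hrun c|exact: measurableC].
    - exact: measurable_draws_are hrun c.
    - exact: subIsetl.
  by rewrite add0r; exact: prob_failure_all_kept.
rewrite sumEFin lee_fin big_split/= -big_mkcond/=.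
rewrite (_ : \sum_c kappa * (2 * delta / 3) = 2 * delta / 3); last first.
  rewrite sumr_const card_ffun card_prod !card_ord -[_ *+ (_ ^ _)]mulr_natl natrX mulrA.
  by rewrite -exprMn divff ?gt_eqF// expr1n mul1r.
have := sum_not_all_kept; lra.
Qed.

End Conclusion.

Theorem theorem7 (R : realType) (N K : nat) (hN : (1 <= N)%N) (hNK : (N <= K)%N)
    (eps delta : R) (heps : 0 < eps) (hdelta : 0 < delta < 1)
    (Tr Ts Tb : nat)
    (hTr : Tr = nat_ceil (ln (delta / (3 * K%:R)) / ln (1 - 1 / (4 * K%:R))))
    (hTs : Ts = nat_ceil (8 * N%:R ^+ 2 / eps ^+ 2
                          * ln (6 * N%:R * K%:R / delta)))
    (hTb : Tb = nat_ceil (8 * N%:R ^+ 2 / eps ^+ 2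
                          * ln (6 * K%:R ^+ 2 / delta)))
    (d : measure_display) (T : measurableType d) (P : probability T R)
    (mu : 'M[R]_(N, K))
    (S : 'I_N -> 'I_K -> nat -> {RV P >-> R})
    (hS : reward_model mu S)
    (draw : 'I_N -> nat -> T -> 'I_K) (sig : 'I_N -> nat -> T -> bool)
    (hrun : doaws_run S draw sig Tr Ts Tb)
    (assign : forall m, 'M[R]_(m, K) -> ('I_m -> 'I_K))
    (hassign : forall m (M : 'M[R]_(m, K)), (m <= K)%N ->
       optimal_assignment M (@assign m M)) :
  optimal_after P mu
    (fun n t w => doaws_arm Tr Ts Tb assign
       (fun m s => draw m s w) (fun m s => sig m s w) n t)
    eps delta (Tr + K * Ts + K * Tb)%N.
Proof.
move=> t pistar t_late pistar_opt.
have K0 : (0 < K)%N := leq_trans hN hNK.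
have K1 : 1 <= K%:R :> R by rewrite ler1n.
have N1 : 1 <= N%:R :> R by rewrite ler1n.
have /andP[d0 d1] := hdelta.
have [Tr0] := hopping_rounds_le K0 hdelta; rewrite -hTr => Tr_le.
(* Arguments above 1 make the logarithms, and hence the sample sizes, positive. *)
have ys : 1 < 6 * N%:R * K%:R / delta by rewrite ltr_pdivlMr//; nra.
have yb : 1 < 6 * K%:R ^+ 2 / delta by rewrite ltr_pdivlMr//; nra.
have [Ts0] := sampling_rounds_le hN heps ys; rewrite -hTs => Ts_le.
have [Tb0] := sampling_rounds_le hN heps yb; rewrite -hTb => Tb_le.
rewrite -hTr in Tr0; rewrite -hTs in Ts0; rewrite -hTb in Tb0.
have Ts_le' : 2 * expR (- (2 * Ts%:R * (eps / (4 * N%:R)) ^+ 2)) <=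
    delta / (3 * N%:R * K%:R).
  by apply: le_trans Ts_le _; rewrite le_eqVlt; apply/orP; left; apply/eqP; field;
    apply/and3P; split; lra.
have Tb_le' : 2 * expR (- (2 * Tb%:R * (eps / (4 * N%:R)) ^+ 2)) <=
    delta / (3 * K%:R ^+ 2).
  by apply: le_trans Tb_le _; rewrite le_eqVlt; apply/orP; left; apply/eqP; field;
    apply/andP; split; lra.
(* [Tr] is positive, so it has the form [r.+1] under which the patterns are indexed. *)
case: Tr Tr0 {hTr} => // r _ in hrun Tr_le t_late *.
exact: (prob_success hN hNK Ts0 Tb0 hS hrun hassign t_late pistar_opt heps
  Tr_le Ts_le' Tb_le').
Qed.
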